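(* In the setting described in the context, let $A>0$ and suppose that one of the following holds: (a) $\gamma_n=\frac{A}{n}$ for all sufficiently large $n$; or (b) $\gamma_n=\frac{\omega_{n+1}}{\sum_{i=0}^{n+1}\omega_i}$ for all $n\ge 0$, where $(\omega_n)_{n\ge0}$ is a sequence of positive numbers with $\omega_n=n^{A-1}$ for all $n\ge1$. Then for every $\theta<\min\left(RA,\tfrac12\right)$ there exists a random (almost surely finite) constant $C>0$ such that, almost surely, $$\forall n\ge1,\quad \|x_n-\nu\|\le C\,n^{-\theta}.$$
   Context: Let $F$ be a finite set containing an element $0$, and $F^*=F\setminus\{0\}$ with cardinality $d\ge 2$. Let $P=(P_{i,j})_{i,j\in F}$ be a stochastic matrix such that $0$ is absorbing ($P_{0,i}=0$ for all $i\in F^*$), $P_{i,0}>0$ for some $i\in F^*$, and $F^*$ is an irreducible class: $\sum_{k\ge 0}(P^k)_{i,j}>0$ for all $i,j\in F^*$. No aperiodicity is assumed. Let $\hat P=(P_{i,j})_{i,j\in F^*}$. Let $\Delta$ be the set of probability measures on $F^*$, identified with the unit simplex of $\mathbb{R}^d$. Put $\|x\|=\sum_{i\in F^*}|x(i)|$. The quasi-stationary distribution $\nu$ is the unique element of $\Delta$ such that $\nu\hat P=\lambda\nu$ for some $\lambda\in(0,1)$; one has $\lambda = 1-\sum_{i\in F^*}\nu(i)P_{i,0}$. The eigenvalues of $\hat P$, with multiplicity, are $\lambda_1=\lambda,\lambda_2,\dots,\lambda_d$, with $1>\lambda_1\ge|\lambda_2|\ge\dots\ge|\lambda_d|\ge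 0$ and $\lambda_i\ne\lambda$ for $i\ge2$. Set $$R=1-(1-\lambda)\max_{i\ge2}\mathrm{Re}\left(\frac1{1-\lambda_i}\right),$$ which is positive. For $x\in\Delta$ let $K[x]$ be the Markov kernel on $F^*$ given by $K[x]_{i,j}=P_{i,j}+P_{i,0}\,x(j)$. Let $(\gamma_n)_{n\ge0}$ be a decreasing sequence in $(0,1)$ with $\sum_{n}\gamma_n=+\infty$ and $\lim_{n\to\infty}\gamma_n\ln n=0$. Let $(X_n)_{n\ge0}$ be an $F^*$-valued process and $(x_n)_{n\ge0}$ a $\Delta$-valued process such that, with $\mathcal F_n=\sigma(X_k: k\le n)$: $x_0$ is $\mathcal F_0$-measurable (e.g. $x_0=\delta_{X_0}$), and for all $n\ge0$, $$\mathbb P(X_{n+1}=j\mid\mathcal F_n)=K[x_n]_{i,j}\ \text{ on } \{X_n=i\},\quad i,j\in F^*,\qquad x_{n+1}=(1-\gamma_n)x_n+\gamma_n\delta_{X_{n+1}}.$$ If $x_0=\delta_{X_0}$ and $\gamma_n=\omega_{n+1}/\sum_{i=0}^{n+1}\omega_i$ with positive weights $\omega_i$, then $x_n=\sum_{i=0}^n\omega_i\delta_{X_i}/\sum_{i=0}^n\omega_i$. *)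

(* Defs.v *)
From HB Require Import structures.
From mathcomp Require Import all_boot all_order all_algebra.
From mathcomp Require Import complex.
From mathcomp Require Import all_classical all_reals all_analysis.
Set Implicit Arguments.
Unset Strict Implicit.
Unset Printing Implicit Defensive.
Import Order.TTheory GRing.Theory Num.Theory.
Import numFieldNormedType.Exports.
Local Open Scope classical_set_scope.
Local Open Scope ring_scope.

(* F^*, the state space F deprived of its cemetery point o (written 0 in the
   literature on quasi-stationary distributions). *)
Notation star o := {i | i != o}.

Section Chain.
Context {R : realType} {F : finType}.

Definition stochastic (P : F -> F -> R) : Prop :=
  (forall i j, 0 <= P i j) /\ (forall i, \sum_j P i j = 1).

Definition mx_of_kernel {T : finType} (P : T -> T -> R) : 'M[R]_#|T| :=
  \matrix_(i, j) P (enum_val i) (enum_val j).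

(* (P^k)_{i,j} *)
Definition kernel_iter (P : F -> F -> R) (k : nat) (i j : F) : R :=
  (mx_of_kernel P ^+ k) (enum_rank i) (enum_rank j).

(* The series may diverge (to +oo), hence the extended reals. *)
Definition irreducible_class (P : F -> F -> R) (o : F) : Prop :=
  forall i j : star o,
    (0 < \sum_(0 <= k <oo) (kernel_iter P k (val i) (val j))%:E)%E.

Definition hat (P : F -> F -> R) (o : F) (i j : star o) : R :=
  P (val i) (val j).

Definition simplex {T : finType} : set (T -> R) :=
  [set x | (forall i, 0 <= x i) /\ \sum_i x i = 1].

Definition norm1 {T : finType} (x : T -> R) : R := \sum_i `|x i|.

Definition is_qsd (P : F -> F -> R) (o : F) (lambda : R) (nu : star o -> R) :
    Prop :=
  [/\ simplex nu, 0 < lambda < 1 &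
      forall j, \sum_i nu i * hat P i j = lambda * nu j].

(* [lam] lists, with 1-based indices 1, ..., d, the complex eigenvalues of
   \hat P with algebraic multiplicity, the first one being lambda and the
   others being sorted by decreasing modulus. *)
Definition eigenvalue_list (P : F -> F -> R) (o : F) (lambda : R)
    (lam : nat -> R[i]) : Prop :=
  let d := #|{: star o}| in
  [/\ char_poly (map_mx (real_complex R) (mx_of_kernel (@hat P o))) =
        \prod_(1 <= i < d.+1) ('X - (lam i)%:P),
      lam 1%N = real_complex R lambda &
      forall i j, (2 <= i)%N -> (i <= j)%N -> (j <= d)%N ->
        `|lam j| <= `|lam i|].

(* R = 1 - (1 - lambda) max_{i >= 2} Re (1 / (1 - lambda_i)).  The default value of the iterated maximum is
   its term of index 2, which belongs to the range as soon as d >= 2. *)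
Definition rate (d : nat) (lambda : R) (lam : nat -> R[i]) : R :=
  1 - (1 - lambda) *
    \big[Num.max/complex.Re (1 / (1 - lam 2%N))]_(2 <= i < d.+1)
      complex.Re (1 / (1 - lam i)).

(* K[x]_{i,j} *)
Definition resampling_kernel (P : F -> F -> R) (o : F) (x : star o -> R)
    (i j : star o) : R :=
  P (val i) (val j) + P (val i) o * x j.

End Chain.

Definition dirac_mass {R : realType} {T : finType} (j : T) : T -> R :=
  fun i => (i == j)%:R.

(* sigma(X_k : k <= n), for processes with values in a finite set *)
Definition history {Omega : Type} {T : finType} (X : nat -> Omega -> T)
    (n : nat) : set (set Omega) :=
  <<s [set E | exists k j, (k <= n)%N /\ E = X k @^-1` [set j]] >>.

Definition measurable_wrt {R : realType} {Omega : Type} (G : set (set Omega))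
    (g : Omega -> R) : Prop :=
  forall B : set R, measurable B -> G (g @^-1` B).

(* g is a version of the conditional probability Pr(E | G). *)
Definition is_cond_prob {R : realType} {d : measure_display}
    {Omega : measurableType d} (Pr : probability Omega R)
    (G : set (set Omega)) (E : set Omega) (g : Omega -> R) : Prop :=
  measurable_wrt G g /\
  forall A, G A -> (\int[Pr]_(w in A) (g w)%:E = Pr (A `&` E))%E.

(* Main.v *)
Require Import Defs.
From HB Require Import structures.
From mathcomp Require Import all_boot all_order all_algebra.
From mathcomp Require Import complex.
From mathcomp Require Import ring lra.
From mathcomp Require Import all_classical all_reals all_analysis.
From mathcomp Require Import measurable_realfun.
Set Implicit Arguments.
Unset Strict Implicit.
Unset Printing Implicit Defensive.
Import Order.TTheory GRing.Theory Num.Theory.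
Import numFieldNormedType.Exports.
Local Open Scope classical_set_scope.
Local Open Scope ring_scope.

(** Let M be the killed matrix, G = (1 - M)^-1 and h > 0 the right Perron
    eigenvector.  The mean dynamics x' = x G / (x G 1) - x becomes, in the
    projective coordinates y = x / (x h), the linear equation
    y' = (x G 1)^-1 y B with B = G - (1 - lambda)^-1, up to the scalar clock
    1 / (x G 1).  It fixes nu, and on the hyperplane {z | z h = 0} the
    eigenvalues of B are 1 / (1 - lambda_i) - 1 / (1 - lambda), i >= 2, whose
    real parts are at most - R / (1 - lambda).  Since the clock is bounded
    below, this gives global convergence; since it tends to 1 - lambda at nu,
    it then gives the rate R.

    The matrix G solves the Poisson equation of every frozen kernel K[x]
    explicitly, so that y_{n+1} - y_n is gamma_n times the linear drift plus a
    martingale increment, a telescoping term and a term of order gamma_n^2, all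
    of whose tail sums are O(n^-theta) for theta < 1/2.  For the martingale this
    follows from the L^2 maximal inequality, applied to the increments divided
    by n^-theta, and Abel summation.

    The linear recursion is solved along the chain
    z prod_{2 <= i < j} (M - lambda_i), which vanishes for j = d + 1 by the
    Cayley-Hamilton theorem: going down in j, every step is a scalar complex
    recursion. *)

(** * Powers of n and tail sums *)

Section Decay.
Context {R : realType}.
Implicit Types (theta : R) (m n k : nat).

(** Up to its clock the projective equation is exactly linear, so no error from linearising at nu
    has to be controlled, and one fixed matrix B governs the whole random trajectory. The clock
    itself is random and its value near nu is known only after convergence; hence one decay
    statement is applied twice, the first time with a small exponent.

    Steps of order 1/n are not summable, so the errors cannot all be bounded in absolute value. They
    are measured by their sums over ranges [m, n), where the martingale and the telescoping terms
    cancel. The bound 1/2 arises there: the increments weighted by n^theta have second moments of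
    order n^(2 theta - 2), summable exactly when theta < 1/2.

    The killed matrix may fail to be diagonalisable. A Jordan block would contribute powers of ln n;
    along the chain of products the strict inequality theta < R A absorbs them, because every level
    may be forced by the next one at the very order n^-theta that is to be proved. *)

Definition decay theta n : R := n%:R `^ (- theta).

Lemma decay_ge0 theta n : 0 <= decay theta n.
Proof. exact: powR_ge0. Qed.

Lemma decay_gt0 theta n : (0 < n)%N -> 0 < decay theta n.
Proof. by move=> n0; apply: powR_gt0; rewrite ltr0n. Qed.

Lemma decayE theta n : (0 < n)%N -> decay theta n = expR (- theta * ln n%:R).
Proof. by move=> n0; rewrite /decay /powR gt_eqF ?ltr0n. Qed.

Lemma ler_decay theta m n : 0 <= theta -> (0 < m <= n)%N ->
  decay theta n <= decay theta m.
Proof.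
move=> t0 /andP[m0 mn]; have n0 := leq_trans m0 mn.
rewrite !decayE // ler_expR !mulNr lerN2 ler_wpM2l // ler_ln ?posrE ?ltr0n //.
by rewrite ler_nat.
Qed.

Lemma ler_decay_exp theta theta' n : theta <= theta' -> (0 < n)%N ->
  decay theta' n <= decay theta n.
Proof. by move=> tt n0; rewrite /decay ler_powR ?lerN2 // ler1n. Qed.

Lemma decay0 n : decay 0 n = 1.
Proof. by rewrite /decay oppr0 powRr0. Qed.

(** Both bounds are ln (1 + u) <= u, at u = 1/n and at u = -1/(n+1). *)
Lemma ln_succ_bounds n : (0 < n)%N ->
  n.+1%:R^-1 <= ln n.+1%:R - ln n%:R :> R /\ ln n.+1%:R - ln n%:R <= n%:R^-1 :> R.
Proof.
move=> n0; have n0' : 0 < n%:R :> R by rewrite ltr0n.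
have n1' : 0 < n.+1%:R :> R by rewrite ltr0n.
split; last first.
  rewrite -ln_div ?posrE //.
  have -> : n.+1%:R / n%:R = 1 + n%:R^-1 :> R.
    by rewrite -natr1 mulrDl divff ?gt_eqF // mul1r.
  by apply: le_ln1Dx; apply: lt_trans (_ : 0 < _); rewrite ?invr_gt0 ?ltrN10.
rewrite -[leRHS]opprB lerNr -ln_div ?posrE //.
have -> : n%:R / n.+1%:R = 1 + - n.+1%:R^-1 :> R.
  rewrite -natr1; field; rewrite natr1.
  by rewrite gt_eqF //; apply: lt_le_trans n1' _; rewrite -natr1; lra.
apply: le_ln1Dx; rewrite ltrN2 invf_lt1 ?ltr1n //.
Qed.

Lemma decayS theta n : (0 < n)%N ->
  decay theta n.+1 = decay theta n * expR (- theta * (ln n.+1%:R - ln n%:R)).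
Proof. by move=> n0; rewrite !decayE // -expRD; congr expR; ring. Qed.

(** The comparison sequence loses at most the factor 1 - theta/n per step, so a contraction by 1 -
    kap/n with kap > theta beats it. *)
Lemma decay_succ_ge theta n : 0 <= theta -> (0 < n)%N ->
  decay theta n * (1 - theta / n%:R) <= decay theta n.+1.
Proof.
move=> t0 n0; rewrite decayS // ler_wpM2l ?decay_ge0 //.
apply: le_trans (expR_ge1Dx _).
rewrite lerD2l mulNr lerN2 ler_wpM2l //; exact: (ln_succ_bounds n0).2.
Qed.

(** A discrete derivative of n^-theta, shaped to telescope. The constant comes from 1 - (1 +
    theta/(n+1))^-1 = theta/(n+1+theta) and n + 1 + theta <= (2 + theta) n. *)
Lemma decay_diff_ge theta n : 0 < theta -> (0 < n)%N ->
  decay theta n / n%:R <=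
  (2 + theta) / theta * (decay theta n - decay theta n.+1).
Proof.
move=> t0 n0; have n0' : 0 < n%:R :> R by rewrite ltr0n.
have n1' : 1 <= n%:R :> R by rewrite ler1n.
rewrite decayS //.
set e := expR _.
have he : e <= (1 + theta / n.+1%:R)^-1.
  rewrite /e mulNr expRN lef_pV2 ?posrE ?expR_gt0 //; last first.
    by rewrite addr_gt0 // divr_gt0 // ltr0n.
  apply: le_trans (expR_ge1Dx _).
  rewrite lerD2l ler_wpM2l ?(ltW t0) //; exact: (ln_succ_bounds n0).1.
have -> : (2 + theta) / theta * (decay theta n - decay theta n * e) =
   decay theta n * ((2 + theta) / theta * (1 - e)) by ring.
rewrite ler_wpM2l ?decay_ge0 //.
apply: le_trans (_ : (2 + theta) / theta * (1 - (1 + theta / n.+1%:R)^-1) <= _).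
  rewrite -(natr1 n).
  have -> : (2 + theta) / theta * (1 - (1 + theta / (n%:R + 1))^-1) =
            (2 + theta) / (n%:R + 1 + theta).
    field; rewrite !gt_eqF //; lra.
  rewrite ler_pdivlMr; last lra.
  rewrite mulrC ler_pdivrMr //; nra.
rewrite ler_wpM2l ?lerD2l ?lerN2 // divr_ge0 // ?(ltW t0) //.
by rewrite addr_ge0 // ltW.
Qed.

Lemma decay_sum theta m n : 0 < theta -> (0 < m)%N ->
  \sum_(m <= k < n) decay theta k / k%:R <= (2 + theta) / theta * decay theta m.
Proof.
move=> t0 m0; have C0 : 0 <= (2 + theta) / theta.
  by rewrite divr_ge0 ?addr_ge0 // ltW.
have [nm|mn] := leqP n m.
  by rewrite big_geq // mulr_ge0 ?decay_ge0.
apply: le_trans (_ : \sum_(m <= k < n)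
    (2 + theta) / theta * (decay theta k - decay theta k.+1) <= _).
  rewrite !big_nat; apply: ler_sum => k /andP[mk _].
  by apply: decay_diff_ge => //; apply: leq_trans m0 mk.
rewrite -mulr_sumr ler_wpM2l //.
have -> : \sum_(m <= k < n) (decay theta k - decay theta k.+1) =
   - \sum_(m <= k < n) (decay theta k.+1 - decay theta k).
  by rewrite -sumrN; apply: eq_bigr => k _; rewrite opprB.
rewrite telescope_sumr ?(ltnW mn) //.
rewrite opprB lerBlDr lerDl; exact: decay_ge0.
Qed.

Lemma sqrV_le_decay theta n : theta <= 1 -> (0 < n)%N ->
  n%:R^-1 ^+ 2 <= decay theta n / n%:R :> R.
Proof.
move=> t1 n0; rewrite expr2 ler_wpM2r ?invr_ge0 //.
rewrite -powR_inv1 // -/(decay 1 n); exact: ler_decay_exp.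
Qed.

Lemma invr_le_decay theta n : theta <= 1 -> (0 < n)%N ->
  n%:R^-1 <= decay theta n :> R.
Proof.
by move=> t1 n0; rewrite -powR_inv1 // -/(decay 1 n); exact: ler_decay_exp.
Qed.

Lemma decay_small theta e : 0 < theta -> 0 < e ->
  exists N, forall n, (N <= n)%N -> decay theta n <= e.
Proof.
move=> t0 e0; pose K := (e * theta)^-1.
have K0 : 0 < K by rewrite invr_gt0 mulr_gt0.
exists (Num.truncn (expR K)).+1 => n hn.
have n0 : (0 < n)%N by apply: leq_trans hn.
have lnK : K <= ln n%:R.
  rewrite -[leLHS]expRK ler_ln ?posrE ?expR_gt0 ?ltr0n //.
  by apply: le_trans (ltW (truncnS_gt _)) _; rewrite ler_nat.
rewrite decayE // mulNr expRN.
have tK : theta * K = e^-1 by rewrite /K invfM mulrCA mulfV ?mulr1 ?gt_eqF.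
rewrite -[leRHS]invrK lef_pV2 ?posrE ?expR_gt0 ?invr_gt0 //.
apply: le_trans (expR_ge1Dx _); rewrite -tK.
by rewrite -[leLHS]add0r lerD // ler_wpM2l // ltW.
Qed.

(** Summation by parts moves the differences from [u] to the weights [c], so that boundedness of [u]
    suffices. It serves the telescoping terms and the weighted martingale alike. *)
Lemma abel_bound (c u : nat -> R) (L V : R) m n : (m <= n)%N ->
  (forall k, `|u k| <= L) ->
  \sum_(m <= k < n) `|c k.+1 - c k| <= V ->
  `|\sum_(m <= k < n) c k * (u k.+1 - u k)| <= L * (`|c m| + `|c n| + V).
Proof.
move=> mn uL cV.
have L0 : 0 <= L by apply: le_trans (uL 0%N).
have -> : \sum_(m <= k < n) c k * (u k.+1 - u k) =
    c n * u n - c m * u m - \sum_(m <= k < n) (c k.+1 - c k) * u k.+1.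
  rewrite -(telescope_sumr (fun k => c k * u k)) // -sumrB.
  by apply: eq_bigr => k _; ring.
have h1 : `|\sum_(m <= k < n) (c k.+1 - c k) * u k.+1| <= V * L.
  apply: le_trans (ler_norm_sum _ _ _) _.
  apply: le_trans (_ : \sum_(m <= k < n) `|c k.+1 - c k| * L <= _).
    by apply: ler_sum => k _; rewrite normrM ler_wpM2l.
  by rewrite -mulr_suml ler_wpM2r.
have h2 : `|c n * u n| <= `|c n| * L by rewrite normrM ler_wpM2l.
have h3 : `|c m * u m| <= `|c m| * L by rewrite normrM ler_wpM2l.
apply: le_trans (ler_normB _ _) _.
apply: le_trans (lerD (ler_normB _ _) h1) _.
apply: le_trans (lerD (lerD h2 h3) (lexx _)) _.
by rewrite le_eqVlt; apply/orP; left; apply/eqP; ring.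
Qed.

(** Finite ranges, uniformly in their upper end: cancellation is kept, and no series has to be shown
    convergent. *)
Definition small_tails theta (r : nat -> R) : Prop :=
  exists L, forall m n, (0 < m <= n)%N ->
    `|\sum_(m <= k < n) r k| <= L * decay theta m.

Lemma small_tailsD theta r s :
  small_tails theta r -> small_tails theta s -> small_tails theta (fun n => r n + s n).
Proof.
move=> [L hL] [M hM]; exists (L + M) => m n mn.
by rewrite big_split /= mulrDl; apply: le_trans (ler_normD _ _) (lerD (hL _ _ mn) (hM _ _ mn)).
Qed.

Lemma small_tailsZ theta a r :
  small_tails theta r -> small_tails theta (fun n => a * r n).
Proof.
move=> [L hL]; exists (`|a| * L) => m n mn.
by rewrite -mulr_sumr normrM -mulrA ler_wpM2l // hL.
Qed.

Lemma small_tails0 theta : small_tails theta (fun _ => 0).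
Proof. by exists 0 => m n _; rewrite big1 // normr0 mul0r. Qed.

Lemma eq_small_tails theta r s : (forall n, (0 < n)%N -> r n = s n) ->
  small_tails theta r -> small_tails theta s.
Proof.
move=> rs [L hL]; exists L => m n mn; rewrite -(eq_big_nat _ _ (F1 := r)) ?hL //.
by move=> k /andP[mk _]; apply: rs; case/andP: mn => m0 _; apply: leq_trans mk.
Qed.

Lemma small_tails_sum (I : Type) (s : seq I) theta (r : I -> nat -> R) :
  (forall i, small_tails theta (r i)) ->
  small_tails theta (fun n => \sum_(i <- s) r i n).
Proof.
move=> h; elim: s => [|i s IH].
  by apply: eq_small_tails (small_tails0 theta) => n _; rewrite big_nil.
by apply: eq_small_tails (small_tailsD (h i) IH) => n _; rewrite big_cons.
Qed.

Lemma small_tails_weaken theta theta' r : theta <= theta' ->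
  small_tails theta' r -> small_tails theta r.
Proof.
move=> tt [L hL]; exists `|L| => m n mn; have /andP[m0 _] := mn.
apply: le_trans (hL _ _ mn) _.
apply: le_trans (_ : `|L| * decay theta' m <= _).
  by rewrite ler_wpM2r ?decay_ge0 ?ler_norm.
by rewrite ler_wpM2l // ler_decay_exp.
Qed.

Lemma small_tails_summable theta L r : 0 < theta ->
  (forall n, (0 < n)%N -> `|r n| <= L * (decay theta n / n%:R)) ->
  small_tails theta r.
Proof.
move=> t0 hr; exists (`|L| * ((2 + theta) / theta)) => m n /andP[m0 mn].
apply: le_trans (ler_norm_sum _ _ _) _.
apply: le_trans (_ : \sum_(m <= k < n) `|L| * (decay theta k / k%:R) <= _).
  rewrite !big_nat; apply: ler_sum => k /andP[mk _].
  have k0 := leq_trans m0 mk; apply: le_trans (hr _ k0) _.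
  by rewrite ler_wpM2r ?ler_norm // divr_ge0 ?decay_ge0.
by rewrite -mulr_sumr -mulrA ler_wpM2l // decay_sum.
Qed.

Lemma small_tails_sqr theta L r : 0 < theta <= 1 ->
  (forall n, (0 < n)%N -> `|r n| <= L * n%:R^-1 ^+ 2) -> small_tails theta r.
Proof.
move=> /andP[t0 t1] hr; apply: (@small_tails_summable _ `|L|) => // n n0.
apply: le_trans (hr _ n0) _.
apply: le_trans (_ : `|L| * n%:R^-1 ^+ 2 <= _).
  by rewrite ler_wpM2r ?ler_norm // exprn_ge0 // invr_ge0.
by rewrite ler_wpM2l // sqrV_le_decay.
Qed.

(** The weight g s has small variation beyond m: the part due to g telescopes to at most S g_m by
    monotonicity, and the part due to s is at most S g_k^2, of order 1/k^2. *)
Lemma small_tails_telescope theta (g s u : nat -> R) (G S L : R) : 0 < theta <= 1 ->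
  (forall n, 0 <= g n) -> nonincreasing_seq g ->
  (forall n, (0 < n)%N -> g n <= G / n%:R) ->
  (forall n, `|s n| <= S) -> (forall n, `|s n.+1 - s n| <= S * g n) ->
  (forall n, `|u n| <= L) ->
  small_tails theta (fun n => g n * s n * (u n.+1 - u n)).
Proof.
move=> /andP[t0 t1] g0 gdec gG sS sd uL.
have S0 : 0 <= S by apply: le_trans (sS 0%N).
have L0 : 0 <= L by apply: le_trans (uL 0%N).
have G0 : 0 <= G by have := gG 1%N isT; rewrite divr1; apply: le_trans.
have gd n : g n.+1 <= g n by apply: gdec.
exists (L * (3 * S * G + S * G ^+ 2 * ((2 + theta) / theta))) => m n /andP[m0 mn].
have gm : g m <= G * decay theta m.
  by apply: le_trans (gG _ m0) _; rewrite ler_wpM2l // invr_le_decay.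
have gn : g n <= g m by apply: gdec.
pose V := S * g m + S * G ^+ 2 * ((2 + theta) / theta) * decay theta m.
have hV : \sum_(m <= k < n) `|g k.+1 * s k.+1 - g k * s k| <= V.
  apply: le_trans (_ : \sum_(m <= k < n)
     (S * - (g k.+1 - g k) + S * G ^+ 2 * (decay theta k / k%:R)) <= _).
    rewrite !big_nat; apply: ler_sum => k /andP[mk _].
    have k0 := leq_trans m0 mk.
    have -> : g k.+1 * s k.+1 - g k * s k =
      (g k.+1 - g k) * s k.+1 + g k * (s k.+1 - s k) by ring.
    apply: le_trans (ler_normD _ _) _; apply: lerD.
      rewrite normrM mulrC ler_pM // ler0_norm // subr_le0 //.
    rewrite normrM ger0_norm //.
    apply: le_trans (_ : g k * (S * g k) <= _); first by rewrite ler_wpM2l.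
    rewrite mulrCA -mulrA ler_wpM2l // -expr2.
    apply: le_trans (_ : (G / k%:R) ^+ 2 <= _).
      by rewrite ler_pXn2r // ?nnegrE ?gG // divr_ge0.
    by rewrite exprMn ler_wpM2l ?exprn_ge0 // sqrV_le_decay.
  rewrite big_split /= -!mulr_sumr sumrN telescope_sumr // /V lerD //.
    by rewrite ler_wpM2l // opprB lerBlDr lerDl.
  by rewrite -!mulrA !ler_wpM2l ?exprn_ge0 // mulrA decay_sum.
apply: le_trans (abel_bound mn uL hV) _.
rewrite -mulrA ler_wpM2l // !normrM !(ger0_norm (g0 _)).
have h1 : g m * `|s m| <= S * (G * decay theta m).
  by rewrite mulrC ler_pM.
have h2 : g n * `|s n| <= S * (G * decay theta m).
  by rewrite mulrC ler_pM // (le_trans gn).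
apply: le_trans (lerD (lerD h1 h2) (lexx _)) _.
rewrite /V.
have h3 : S * g m <= S * (G * decay theta m) by rewrite ler_wpM2l.
apply: le_trans (lerD (lexx _) (lerD h3 (lexx _))) _.
by rewrite le_eqVlt; apply/orP; left; apply/eqP; ring.
Qed.

(** Abel summation with the monotone weights n^-theta, whose variation beyond m is at most
    m^-theta. *)
Lemma small_tails_weighted theta (xi : nat -> R) (L : R) : 0 < theta ->
  (forall n, `|\sum_(0 <= k < n) (decay theta k)^-1 * xi k| <= L) ->
  small_tails theta xi.
Proof.
move=> t0 hL; exists (L * 3) => m n /andP[m0 mn].
pose u n := \sum_(0 <= k < n) (decay theta k)^-1 * xi k.
have -> : \sum_(m <= k < n) xi k = \sum_(m <= k < n) decay theta k * (u k.+1 - u k).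
  apply: eq_big_nat => k /andP[mk _]; have k0 := leq_trans m0 mk.
  by rewrite /u big_nat_recr //= addrAC subrr add0r mulrA divff ?mul1r ?gt_eqF ?decay_gt0.
have hV : \sum_(m <= k < n) `|decay theta k.+1 - decay theta k| <= decay theta m.
  apply: le_trans (_ : \sum_(m <= k < n) - (decay theta k.+1 - decay theta k) <= _).
    rewrite !big_nat; apply: ler_sum => k /andP[mk _].
    rewrite ler0_norm // subr_le0; apply: ler_decay; first exact: ltW.
    by rewrite (leq_trans m0 mk) /=.
  by rewrite sumrN telescope_sumr // opprB lerBlDr lerDl decay_ge0.
have L0 : 0 <= L by apply: le_trans (hL 0%N).
apply: le_trans (abel_bound mn hL hV) _.
rewrite -mulrA ler_wpM2l // !ger0_norm ?decay_ge0 //.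
have : decay theta n <= decay theta m by apply: ler_decay; rewrite ?m0 //; exact: ltW.
lra.
Qed.

End Decay.

(** * Perturbed scalar recursions *)

Section ComplexContraction.
Context {R : realType}.
Implicit Types (z : R[i]) (theta : R) (m n k : nat).

(** A modulus with values in [R]; the norm of [R[i]] is itself an element of [R[i]]. *)
Definition cmod z : R := Normc.normc z.

Lemma cmodM z w : cmod (z * w) = cmod z * cmod w.
Proof. exact: Normc.normcM. Qed.

Lemma cmod0 : cmod 0 = 0.
Proof. exact: Normc.normc0. Qed.

Lemma cmod_ge0 z : 0 <= cmod z.
Proof. by case: z => a b; rewrite /cmod /= sqrtr_ge0. Qed.

Lemma ler_cmodD z w : cmod (z + w) <= cmod z + cmod w.
Proof. exact: le_normcD. Qed.

Lemma cmodN z : cmod (- z) = cmod z.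
Proof. exact: normcN. Qed.

Lemma cmod_real (a : R) : cmod (real_complex R a) = `|a|.
Proof. by rewrite /cmod /= expr0n addr0 sqrtr_sqr. Qed.

(** To first order in t only the real part of z matters. The lower bound on t Re z keeps the
    right-hand side nonnegative, so that both sides may be squared. *)
Lemma cmod_1Dt z (t : R) : 0 <= t -> - 2^-1 <= t * complex.Re z ->
  cmod (1 + real_complex R t * z) <= 1 + t * complex.Re z + t ^+ 2 * cmod z ^+ 2.
Proof.
case: z => a b t0 h; rewrite /cmod /=; simpc => /=; rewrite /= in h.
rewrite sqr_sqrtr; last by rewrite addr_ge0 ?sqr_ge0.
have h0 : 0 <= 1 + t * a + t ^+ 2 * (a ^+ 2 + b ^+ 2).
  have := sqr_ge0 (t * a); have := sqr_ge0 (t * b); nra.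
rewrite -[leRHS]ger0_norm // -sqrtr_sqr ler_sqrt ?sqr_ge0 //.
have := sqr_ge0 (t * a); have := sqr_ge0 (t * b); nra.
Qed.

Definition decays theta (v : nat -> R[i]) : Prop :=
  exists L, forall n, (0 < n)%N -> cmod (v n) <= L * decay theta n.

Lemma decays_eventually theta v L N :
  (forall n, (0 < n)%N -> (N <= n)%N -> cmod (v n) <= L * decay theta n) ->
  decays theta v.
Proof.
move=> h; exists (`|L| + \sum_(k < N) cmod (v k) / decay theta k) => n n0.
have S0 : 0 <= \sum_(k < N) cmod (v k) / decay theta k.
  by apply: sumr_ge0 => k _; rewrite divr_ge0 ?cmod_ge0 ?decay_ge0.
have [Nn|nN] := leqP N n.
  apply: le_trans (h _ n0 Nn) _; rewrite ler_wpM2r ?decay_ge0 //.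
  by apply: le_trans (ler_norm _) _; rewrite lerDl.
rewrite -ler_pdivrMr ?decay_gt0 //.
rewrite (bigD1 (Ordinal nN)) //= addrCA lerDl addr_ge0 //.
by apply: sumr_ge0 => k _; rewrite divr_ge0 ?cmod_ge0 ?decay_ge0.
Qed.

Lemma decaysD theta v w :
  decays theta v -> decays theta w -> decays theta (fun n => v n + w n).
Proof.
move=> [L hL] [M hM]; exists (L + M) => n n0; rewrite mulrDl.
by apply: le_trans (ler_cmodD _ _) (lerD (hL _ n0) (hM _ n0)).
Qed.

Lemma decaysZ theta z v : decays theta v -> decays theta (fun n => v n * z).
Proof.
move=> [L hL]; exists (L * cmod z) => n n0.
by rewrite cmodM mulrAC ler_wpM2r ?cmod_ge0 ?hL.
Qed.

Lemma decays0 theta : decays theta (fun _ => 0).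
Proof. by exists 0 => n _; rewrite cmod0 mul0r. Qed.

Lemma eq_decays theta v w : (forall n, v n = w n) -> decays theta v -> decays theta w.
Proof. by move=> e [L hL]; exists L => n n0; rewrite -e hL. Qed.

Lemma decays_sum (I : Type) (s : seq I) theta (v : I -> nat -> R[i]) :
  (forall i, decays theta (v i)) -> decays theta (fun n => \sum_(i <- s) v i n).
Proof.
move=> h; elim: s => [|i s IH].
  by apply: eq_decays (decays0 theta) => n; rewrite big_nil.
by apply: eq_decays (decaysD (h i) IH) => n; rewrite big_cons.
Qed.

Definition small_ctails theta (r : nat -> R[i]) : Prop :=
  exists L, forall m n, (0 < m <= n)%N ->
    cmod (\sum_(m <= k < n) r k) <= L * decay theta m.

Lemma small_ctails_comb (I : Type) (s : seq I) theta (r : I -> nat -> R) (z : I -> R[i]) :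
  (forall i, small_tails theta (r i)) ->
  small_ctails theta (fun n => \sum_(i <- s) real_complex R (r i n) * z i).
Proof.
move=> h; elim: s => [|i s [L hL]].
  by exists 0 => m n _; rewrite big1 ?cmod0 ?mul0r // => k _; rewrite big_nil.
have [M hM] := h i; exists (M * cmod (z i) + L) => m n mn.
under eq_bigr do rewrite big_cons; rewrite big_split /= mulrDl.
apply: le_trans (ler_cmodD _ _) _; apply: lerD; last exact: hL.
rewrite -mulr_suml cmodM mulrAC ler_wpM2r ?cmod_ge0 //.
by rewrite -(raddf_sum (real_complex R)) cmod_real hM.
Qed.

(** The multiplier has modulus at most 1 - kap/n with kap > theta, while n^-theta shrinks only by 1
    - theta/n. The difference pays for the forcing: [f] may have the order of the conclusion because
    it comes multiplied by t_n = O(1/n). The term [r] has no such factor and is controlled by its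
    tails only. *)
Lemma perturbed_contraction theta kappa (mu : R[i]) (T : R) (t : nat -> R)
    (v f r : nat -> R[i]) :
  0 < theta < kappa ->
  (forall n, (0 < n)%N -> 0 <= t n <= T / n%:R) ->
  (exists N, forall n, (N <= n)%N -> kappa / n%:R <= t n * - complex.Re mu) ->
  decays theta f -> small_ctails theta r ->
  (forall n, (0 < n)%N ->
     v n.+1 = v n * (1 + real_complex R (t n) * mu)
              + real_complex R (t n) * f n + r n) ->
  decays theta v.
Proof.
move=> /andP[th0 thk] ht [N0 hN0] [F hF] [L hL] hv.
have T0 : 0 <= T.
  by have /andP[a b] := ht 1%N isT; have := le_trans a b; rewrite divr1.
(* The gap kappa - kap absorbs the quadratic term of the modulus, the gap kap - theta the
   forcing. *)
pose kap := (theta + kappa) / 2.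
have kap1 : theta < kap by rewrite /kap; lra.
have kap2 : kap < kappa by rewrite /kap; lra.
pose c := cmod mu.
have c0 : 0 <= c by exact: cmod_ge0.
(* Beyond [N1], t_n |Re mu| <= 1/2; beyond [N2], t_n^2 |mu|^2 <= (kappa - kap)/n. *)
pose N1 := (Num.truncn (2 * T * `|complex.Re mu|)).+1.
pose N2 := (Num.truncn (T ^+ 2 * c ^+ 2 / (kappa - kap))).+1.
pose N := (N0 + N1 + N2)%N.
have contr n : (N <= n)%N ->
    cmod (1 + real_complex R (t n) * mu) <= 1 - kap / n%:R.
  move=> Nn; have n0 : (0 < n)%N by apply: leq_trans Nn; rewrite /N /N2 addnS.
  have n0' : 0 < n%:R :> R by rewrite ltr0n.
  have /andP[tn0 tnT] := ht n n0.
  have e1 : 2 * T * `|complex.Re mu| <= n%:R.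
    apply: ltW; apply: lt_le_trans (truncnS_gt _) _.
    by rewrite ler_nat; apply: leq_trans Nn; rewrite /N -addnA addnCA leq_addr.
  have e2 : T ^+ 2 * c ^+ 2 / (kappa - kap) <= n%:R.
    apply: ltW; apply: lt_le_trans (truncnS_gt _) _.
    by rewrite ler_nat; apply: leq_trans Nn; rewrite /N leq_addl.
  have e3 : kappa / n%:R <= t n * - complex.Re mu.
    by apply: hN0; apply: leq_trans Nn; rewrite /N -addnA leq_addr.
  apply: le_trans (cmod_1Dt tn0 _) _.
    have : t n * `|complex.Re mu| <= T / n%:R * `|complex.Re mu| by rewrite ler_wpM2r.
    have : T / n%:R * `|complex.Re mu| <= 2^-1.
      by rewrite mulrAC ler_pdivrMr //; lra.
    have : t n * - `|complex.Re mu| <= t n * complex.Re mu.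
      by rewrite ler_wpM2l // lerNl -normrN ler_norm.
    lra.
  have e4 : t n ^+ 2 * c ^+ 2 <= (kappa - kap) / n%:R.
    apply: le_trans (_ : (T / n%:R) ^+ 2 * c ^+ 2 <= _).
      by rewrite ler_wpM2r ?sqr_ge0 // ler_pXn2r // nnegrE // divr_ge0.
    rewrite ler_pdivrMr in e2; last by rewrite subr_gt0.
    rewrite exprMn mulrAC expr2 mulrA ler_pM2r ?invr_gt0 //.
    by rewrite ler_pdivrMr // [leRHS]mulrC.
  have -> : kap / n%:R = kappa / n%:R - (kappa - kap) / n%:R by field; rewrite gt_eqF.
  by rewrite -/c; lra.
pose n1 := N.
have n10 : (0 < n1)%N by rewrite /n1 /N /N2 addnS.
pose Q := T * (`|F| + c * `|L|).
(* The first summand starts the induction at [n1]; the second gives Q <= K (kap - theta), which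
   closes each step. *)
pose K := (cmod (v n1) + `|L| * decay theta n1) / decay theta n1 + Q / (kap - theta).
have Q0 : 0 <= Q by rewrite mulr_ge0 // addr_ge0 // mulr_ge0.
have K0 : 0 <= K.
  rewrite /K; apply: addr_ge0; apply: divr_ge0 => //; rewrite ?decay_ge0 //.
    by rewrite addr_ge0 ?cmod_ge0 // mulr_ge0 ?decay_ge0.
  by rewrite subr_ge0 ltW.
have hKQ : Q <= K * (kap - theta).
  rewrite /K mulrDl divfK; last by rewrite gt_eqF // subr_gt0.
  rewrite lerDr mulr_ge0 ?subr_ge0 ?(ltW kap1) // divr_ge0 ?decay_ge0 //.
  by rewrite addr_ge0 ?cmod_ge0 // mulr_ge0 ?decay_ge0.
(* Shift v by the tail of r up to a fixed horizon M: no limit has to be taken. *)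
have shifted M n : (n1 <= n <= M)%N ->
    cmod (v n + \sum_(n <= k < M) r k) <= K * decay theta n.
  have tailL k : (0 < k <= M)%N -> cmod (\sum_(k <= j < M) r j) <= `|L| * decay theta k.
    move=> kM; apply: le_trans (hL _ _ kM) _.
    by rewrite ler_wpM2r ?decay_ge0 // ler_norm.
  move=> /andP[]; elim: n => [|n IH] h1n hnM.
    by move: n10; rewrite ltnNge h1n.
  have [e|ne] := eqVneq n1 n.+1.
    rewrite -e; apply: le_trans (ler_cmodD _ _) _.
    apply: le_trans (lerD (lexx _) (tailL _ _)) _; first by rewrite n10 e.
    rewrite /K mulrDl divfK ?gt_eqF ?decay_gt0 // lerDl.
    by rewrite mulr_ge0 ?decay_ge0 // divr_ge0 // subr_ge0 ltW.
  have h1n' : (n1 <= n)%N by rewrite -ltnS ltn_neqAle ne.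
  have n0 : (0 < n)%N by apply: leq_trans n10 h1n'.
  have n0' : 0 < n%:R :> R by rewrite ltr0n.
  have {}IH := IH h1n' (ltnW hnM).
  have /andP[tn0 tnT] := ht n n0.
  have hS := tailL n; rewrite n0 (ltnW hnM) in hS; have {}hS := hS isT.
  set S := \sum_(n <= k < M) r k in IH hS.
  (* After the shift the perturbation survives only as - t_n mu S: it has acquired the factor t_n
     and joins the forcing. *)
  have -> : v n.+1 + \sum_(n.+1 <= k < M) r k =
     (v n + S) * (1 + real_complex R (t n) * mu) +
     real_complex R (t n) * (f n - mu * S).
    by rewrite hv // /S [in RHS]big_ltn //; ring.
  apply: le_trans (ler_cmodD _ _) _; rewrite !cmodM cmod_real ger0_norm //.
  have h1 : cmod (v n + S) * cmod (1 + real_complex R (t n) * mu) <=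
            K * decay theta n * (1 - kap / n%:R).
    by rewrite ler_pM ?cmod_ge0 // contr.
  have h2 : cmod (f n - mu * S) <= (`|F| + c * `|L|) * decay theta n.
    apply: le_trans (ler_cmodD _ _) _; rewrite cmodN cmodM mulrDl lerD //.
      by apply: le_trans (hF _ n0) _; rewrite ler_wpM2r ?decay_ge0 // ler_norm.
    by rewrite -/c -mulrA ler_wpM2l.
  have h3 : t n * cmod (f n - mu * S) <= Q / n%:R * decay theta n.
    apply: le_trans (_ : T / n%:R * ((`|F| + c * `|L|) * decay theta n) <= _).
      by rewrite ler_pM // cmod_ge0.
    by rewrite /Q le_eqVlt; apply/orP; left; apply/eqP; ring.
  apply: le_trans (lerD h1 h3) _.
  apply: le_trans (_ : K * (decay theta n * (1 - theta / n%:R)) <= _); last first.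
    by rewrite ler_wpM2l // decay_succ_ge // ltW.
  have h4 : Q / n%:R * decay theta n <= K * (kap - theta) / n%:R * decay theta n.
    by rewrite ler_wpM2r ?decay_ge0 // ler_wpM2r // invr_ge0 ltW.
  apply: le_trans (lerD (lexx _) h4) _.
  by rewrite le_eqVlt; apply/orP; left; apply/eqP; ring.
apply: (@decays_eventually _ _ K n1) => n n0 h.
by have := shifted n n; rewrite h leqnn big_geq // addr0; apply.
Qed.

End ComplexContraction.

(** * The killed matrix and its Green matrix *)

Section Perron.
Context {R : realType} {d : nat} (M : 'M[R]_d) (lambda : R) (nu : 'rV[R]_d).
Hypothesis M_ge0 : forall i j, 0 <= M i j.
(** Irreducibility in the form that the Perron arguments use: the support of a nonnegative left
    eigenvector and the zero set of a nonnegative right one are closed under positive entries. *)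
Hypothesis M_irr : forall S : pred 'I_d, (exists i, S i) ->
  (forall i j, S i -> 0 < M i j -> S j) -> forall j, S j.
Hypothesis lambda01 : 0 < lambda < 1.
Hypothesis nu_ge0 : forall i, 0 <= nu 0 i.
Hypothesis nu_sum1 : \sum_i nu 0 i = 1.
Hypothesis nuM : nu *m M = lambda *: nu.

Lemma left_eigenvector_gt0 (v : 'rV[R]_d) : (forall i, 0 <= v 0 i) ->
  v *m M = lambda *: v -> (exists i, 0 < v 0 i) -> forall j, 0 < v 0 j.
Proof.
move=> v0 vM vi; have /andP[l0 _] := lambda01.
apply: (@M_irr (fun j => 0 < v 0 j) vi) => i j vi0 Mij.
have /(congr1 (fun N : 'rV_d => N 0 j)) := vM; rewrite !mxE => e.
rewrite -(pmulr_rgt0 _ l0) -e (bigD1 i) //=.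
by apply: ltr_pwDl; [exact: mulr_gt0 | apply: sumr_ge0 => k _; exact: mulr_ge0].
Qed.

Lemma nu_gt0 i : 0 < nu 0 i.
Proof.
apply: left_eigenvector_gt0 => //; apply: contrapT => h.
have := nu_sum1; rewrite big1 => [/eqP|j _]; first by rewrite eq_sym oner_eq0.
by apply/eqP; rewrite eq_le nu_ge0 andbT leNgt; apply/negP => ?; apply: h; exists j.
Qed.

(** Taking for [c] a positive eigenvector on one side turns an inequality lambda |u| <= M |u|, or
    its transpose, into an equality. *)
Lemma sum_eq_weighted (u w : 'I_d -> R) (c : 'I_d -> R) :
  (forall i, 0 < c i) -> (forall i, u i <= w i) ->
  \sum_i c i * w i <= \sum_i c i * u i -> forall i, w i = u i.
Proof.
move=> c0 uw h i; apply/eqP; rewrite eq_le uw andbT.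
have nn k : 0 <= c k * (w k - u k) by rewrite mulr_ge0 ?subr_ge0 // ltW.
have : \sum_k c k * (w k - u k) <= 0.
  by under eq_bigr do rewrite mulrBr; rewrite sumrB subr_le0.
rewrite (bigD1 i) //= => h'.
have : c i * (w i - u i) <= 0.
  by apply: le_trans h'; rewrite lerDl sumr_ge0.
by rewrite pmulr_rle0 // subr_le0.
Qed.

(** Since nu makes M - lambda singular, lambda has a right eigenvector u. Its modulus satisfies
    lambda |u| <= M |u|, with equality after testing against nu > 0, and irreducibility makes it
    positive. *)
Lemma right_eigenvector : exists h : 'cV[R]_d,
  [/\ forall i, 0 < h i 0, M *m h = lambda *: h & nu *m h = 1%:M].
Proof.
have /andP[l0 l1] := lambda01.
pose N := M - lambda%:M.
have nuN : nu *m N = 0 by rewrite mulmxBr nuM mul_mx_scalar subrr.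
have Nsing : N^T \notin unitmx.
  rewrite unitmx_tr; apply/negP => uN.
  have : nu = 0 by rewrite -[nu](mulmxK uN) nuN mul0mx.
  move=> nu0; have := nu_sum1; rewrite nu0 big1 => [/eqP|j _]; rewrite ?mxE //.
  by rewrite eq_sym oner_eq0.
have /rowV0Pn[u /sub_kermxP uN u0] : kermx N^T != 0 by rewrite kermx_eq0 row_free_unit.
have uM i : \sum_j M i j * u 0 j = lambda * u 0 i.
  have /(congr1 (fun A : 'rV_d => A 0 i)) := uN.
  rewrite /N linearB /= tr_scalar_mx mulmxBr mul_mx_scalar !mxE => /eqP.
  rewrite subr_eq0 => /eqP <-; apply: eq_bigr => j _; rewrite mxE; ring.
have ge i : lambda * `|u 0 i| <= \sum_j M i j * `|u 0 j|.
  rewrite -[X in X * _](ger0_norm (ltW l0)) -normrM -uM.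
  apply: le_trans (ler_norm_sum _ _ _) _; apply: ler_sum => j _.
  by rewrite normrM ger0_norm.
have eig i : \sum_j M i j * `|u 0 j| = lambda * `|u 0 i|.
  apply: (sum_eq_weighted nu_gt0 ge).
  under eq_bigr do rewrite mulr_sumr; rewrite exchange_big /=.
  apply: ler_sum => j _; rewrite [leRHS]mulrCA [leRHS]mulrA.
  have /(congr1 (fun A : 'rV_d => A 0 j)) := nuM; rewrite !mxE => e.
  by rewrite -e mulr_suml; apply: ler_sum => i' _; rewrite mulrA.
have pos i : 0 < `|u 0 i|.
  rewrite lt0r normr_ge0 andbT; apply/negP => /eqP ui.
  case/negP: u0; apply/eqP/rowP => k; rewrite mxE; apply/eqP; rewrite -normr_eq0.
  apply: (@M_irr (fun j => `|u 0 j| == 0)) k; first by exists i; apply/eqP.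
  move=> a b /eqP ua Mab; have := eig a; rewrite ua mulr0.
  move=> /eqP; rewrite psumr_eq0 => [/allP/(_ b)|j _]; last exact: mulr_ge0.
  by rewrite mem_index_enum mulf_eq0 (gt_eqF Mab) => /(_ isT).
pose s := \sum_i nu 0 i * `|u 0 i|.
have s0 : 0 < s.
  have [i _] : exists i : 'I_d, true.
    apply: contrapT => h; have := nu_sum1; rewrite big1 => [/eqP|j _].
      by rewrite eq_sym oner_eq0.
    by case: h; exists j.
  rewrite /s (bigD1 i) //= ltr_pwDl ?mulr_gt0 ?nu_gt0 //.
  by apply: sumr_ge0 => j _; rewrite mulr_ge0.
exists (\col_i (`|u 0 i| / s)); split.
- by move=> i; rewrite mxE divr_gt0.
- apply/colP => i; rewrite !mxE mulrA -eig mulr_suml.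
  by apply: eq_bigr => j _; rewrite mxE mulrA.
apply/matrixP => i j; rewrite !ord1 !mxE.
under eq_bigr do rewrite mxE mulrA.
by rewrite -mulr_suml divff // gt_eqF.
Qed.

Variable h : 'cV[R]_d.
Hypothesis h_gt0 : forall i, 0 < h i 0.
Hypothesis Mh : M *m h = lambda *: h.

Lemma sum_absM_h (u : 'rV[R]_d) :
  \sum_j h j 0 * (\sum_i `|u 0 i| * M i j) = lambda * \sum_j h j 0 * `|u 0 j|.
Proof.
under eq_bigr do rewrite mulr_sumr; rewrite exchange_big mulr_sumr /=.
apply: eq_bigr => i _; rewrite mulrA.
have /(congr1 (fun A : 'cV_d => A i 0)) := Mh; rewrite !mxE => <-.
by rewrite mulr_suml; apply: eq_bigr => j _; ring.
Qed.

Lemma abs_le_absM (u : 'rV[R]_d) (c : R) : u *m M = c *: u ->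
  forall j, `|c| * `|u 0 j| <= \sum_i `|u 0 i| * M i j.
Proof.
move=> uM j; have /(congr1 (fun A : 'rV_d => A 0 j)) := uM; rewrite !mxE => e.
rewrite -normrM -e; apply: le_trans (ler_norm_sum _ _ _) _.
by apply: ler_sum => i _; rewrite normrM (ger0_norm (M_ge0 _ _)).
Qed.

(** If u M = u then |u| <= |u| M, and testing against h gives s <= lambda s for s = |u| h >= 0,
    hence s = 0. *)
Lemma unit_1M : 1%:M - M \in unitmx.
Proof.
have /andP[l0 l1] := lambda01.
rewrite -row_free_unit -kermx_eq0; apply/negP => /negP /rowV0Pn[u /sub_kermxP uN /negP].
apply; apply/eqP/rowP => k; rewrite [RHS]mxE.
have uM : u *m M = 1 *: u.
  by move: uN; rewrite mulmxBr mulmx1 scale1r => /eqP; rewrite subr_eq0 => /eqP <-.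
have le1 : \sum_j h j 0 * `|u 0 j| <= lambda * \sum_j h j 0 * `|u 0 j|.
  rewrite -sum_absM_h; apply: ler_sum => j _; rewrite ler_wpM2l ?(ltW (h_gt0 _)) //.
  by have := abs_le_absM uM j; rewrite normr1 mul1r.
have nn j : 0 <= h j 0 * `|u 0 j| by rewrite mulr_ge0 // ltW.
have s0 : 0 <= \sum_j h j 0 * `|u 0 j| by apply: sumr_ge0.
have /eqP : \sum_j h j 0 * `|u 0 j| = 0 by apply/eqP; rewrite eq_le s0 andbT; nra.
rewrite psumr_eq0 // => /allP/(_ k); rewrite mem_index_enum => /(_ isT) /=.
by rewrite mulf_eq0 gt_eqF //= normr_eq0 => /eqP.
Qed.

(** Here |u| is an eigenvector too, hence so is |u| + u >= 0. One positive entry of u would make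
    this sum positive everywhere, so u > 0, against u h = 0. Thus u <= 0, and u h = 0 with h > 0
    forces u = 0. *)
Lemma left_eigenvector_eq0 (u : 'rV[R]_d) :
  u *m M = lambda *: u -> u *m h = 0 -> u = 0.
Proof.
have /andP[l0 l1] := lambda01; move=> uM uh.
have uh' : \sum_i u 0 i * h i 0 = 0.
  by have /(congr1 (fun A : 'M[R]_1 => A 0 0)) := uh; rewrite !mxE.
have eig j : \sum_i `|u 0 i| * M i j = lambda * `|u 0 j|.
  have ge j' : lambda * `|u 0 j'| <= \sum_i (`|u 0 i| * M i j').
    by have := abs_le_absM uM j'; rewrite ger0_norm // ltW.
  apply: (sum_eq_weighted h_gt0 ge); rewrite sum_absM_h mulr_sumr.
  by apply: ler_sum => i _; rewrite mulrCA.
pose w : 'rV_d := \row_i (`|u 0 i| + u 0 i).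
have w0 i : 0 <= w 0 i by rewrite mxE -lerBlDr sub0r -normrN ler_norm.
have wM : w *m M = lambda *: w.
  apply/rowP => j; rewrite !mxE mulrDr -eig.
  have /(congr1 (fun A : 'rV_d => A 0 j)) := uM; rewrite !mxE => <-.
  by rewrite -big_split; apply: eq_bigr => i _; rewrite mxE mulrDl.
have ule i : u 0 i <= 0.
  rewrite leNgt; apply/negP => ui.
  have wp : forall j, 0 < w 0 j.
    by apply: left_eigenvector_gt0 => //; exists i; rewrite mxE addr_gt0 // normr_gt0 gt_eqF.
  have up j : 0 < u 0 j.
    rewrite ltNge; apply/negP => uj; have := wp j; rewrite mxE ler0_norm // addNr ltxx.
    by [].
  have : 0 < \sum_i u 0 i * h i 0.
    rewrite (bigD1 i) //= ltr_pwDl ?mulr_gt0 //.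
    by apply: sumr_ge0 => j _; rewrite ltW // mulr_gt0.
  by rewrite uh' ltxx.
apply/rowP => k; rewrite [RHS]mxE.
have nn j : 0 <= - u 0 j * h j 0 by rewrite mulr_ge0 ?oppr_ge0 // ltW.
have /eqP : \sum_j - u 0 j * h j 0 = 0.
  by under eq_bigr do rewrite mulNr; rewrite sumrN uh' oppr0.
rewrite psumr_eq0 // => /allP/(_ k); rewrite mem_index_enum => /(_ isT) /=.
by rewrite mulf_eq0 (gt_eqF (h_gt0 _)) orbF oppr_eq0 => /eqP.
Qed.

Variable G : 'M[R]_d.
Hypothesis MG : (1%:M - M) *m G = 1%:M.

Lemma green_comm : G *m (1%:M - M) = 1%:M.
Proof. exact: mulmx1C MG. Qed.

Lemma green_h : G *m h = (1 - lambda)^-1 *: h.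
Proof.
have /andP[_ l1] := lambda01; have l10 : 1 - lambda != 0 by rewrite subr_eq0 gt_eqF.
rewrite -[in RHS](mul1mx h) -green_comm -mulmxA mulmxBl mul1mx Mh.
have -> : h - lambda *: h = (1 - lambda) *: h by rewrite scalerBl scale1r.
by rewrite -scalemxAr scalerA mulVf // scale1r.
Qed.

Lemma nu_green : nu *m G = (1 - lambda)^-1 *: nu.
Proof.
have /andP[_ l1] := lambda01; have l10 : 1 - lambda != 0 by rewrite subr_eq0 gt_eqF.
rewrite -[in RHS](mulmx1 nu) -MG mulmxA mulmxBr mulmx1 nuM.
have -> : nu - lambda *: nu = (1 - lambda) *: nu by rewrite scalerBl scale1r.
by rewrite -scalemxAl scalerA mulVf // scale1r.
Qed.

(** The vector u = G 1 of expected lifetimes solves u = 1 + M u, so the bound reduces to u >= 0. It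
    is what keeps the clock at most 1. *)
Lemma green1_ge1 i : 1 <= (G *m const_mx 1 : 'cV_d) i 0.
Proof.
have /andP[l0 l1] := lambda01.
pose u : 'cV_d := G *m const_mx 1.
have ueq k : u k 0 = 1 + \sum_j M k j * u j 0.
  have /(congr1 (fun A : 'M[R]_d => (A *m (const_mx 1 : 'cV_d)) k 0)) := MG.
  rewrite mul1mx -mulmxA -/u mulmxBl mul1mx !mxE => /eqP.
  by rewrite subr_eq => /eqP ->; rewrite addrC.
suff u0 k : 0 <= u k 0.
  by rewrite -/u ueq lerDl; apply: sumr_ge0 => j _; rewrite mulr_ge0.
(* Minimum principle for the ratio of u to the eigenvector h. *)
pose k0 := [arg min_(j < k) (u j 0 / h j 0)]%O.
have hk0 j : u k0 0 / h k0 0 <= u j 0 / h j 0.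
  by rewrite /k0; case: arg_minP => // m _ hm; exact: hm.
set m := u k0 0 / h k0 0 in hk0.
have uj j : m * h j 0 <= u j 0 by rewrite -ler_pdivlMr.
suff m0 : 0 <= m by apply: le_trans (uj k); rewrite mulr_ge0 // ltW.
have e : u k0 0 = m * h k0 0 by rewrite /m divfK // gt_eqF.
have : 1 + m * (lambda * h k0 0) <= m * h k0 0.
  rewrite -e ueq lerD2l.
  have /(congr1 (fun A : 'cV_d => A k0 0)) := Mh; rewrite !mxE => <-.
  rewrite mulr_sumr; apply: ler_sum => j _; rewrite mulrCA ler_wpM2l //.
move=> le_m; have c0 : 0 < h k0 0 * (1 - lambda) by rewrite mulr_gt0 ?subr_gt0.
rewrite -(pmulr_lge0 m c0); have -> : m * (h k0 0 * (1 - lambda)) =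
  m * h k0 0 - m * (lambda * h k0 0) by ring.
lra.
Qed.

End Perron.

(** * Solving the linear recursion by the Cayley-Hamilton theorem *)

Section Factorisation.
Context {R : realType} {d : nat} (M G : 'M[R]_d) (lambda : R) (h : 'cV[R]_d)
  (lam : nat -> R[i]).
Local Notation RtoC := (real_complex R).
Local Notation cmx := (map_mx RtoC).
Hypothesis lambda1 : lambda < 1.
Hypothesis Mh : M *m h = lambda *: h.
Hypothesis MG : (1%:M - M) *m G = 1%:M.
Hypothesis simple : forall u : 'rV[R]_d, u *m M = lambda *: u -> u *m h = 0 -> u = 0.
Hypothesis lam_char : char_poly (cmx M) = \prod_(1 <= i < d.+1) ('X - (lam i)%:P).
Hypothesis lam1 : lam 1%N = RtoC lambda.

(** The upper index is excluded and the factor of lambda is left out: [factors 2] is the identity,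
    and [factors d.+1] lacks only M - lambda to be the characteristic polynomial at M. *)
Definition factors j : 'M[R[i]]_d := \prod_(2 <= i < j) (cmx M - (lam i)%:M).

Lemma factorsS j : (2 <= j)%N -> factors j.+1 = factors j *m (cmx M - (lam j)%:M).
Proof. by move=> j2; rewrite /factors big_nat_recr. Qed.

Lemma factors_comm (A : 'M[R[i]]_d) j : A *m cmx M = cmx M *m A ->
  A *m factors j = factors j *m A.
Proof.
move=> AM; apply: (@commr_prod _ _ _ _ _ A) => i _.
by rewrite /GRing.comm -!mulmxE mulmxBr mulmxBl AM scalar_mxC.
Qed.

(** Transfers [simple] from real to complex vectors: [f] stands for the real or the imaginary part,
    and M, h and lambda are real. *)
Lemma real_part_eq0 (f : R[i] -> R) (u : 'rV[R[i]]_d) :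
  f 0 = 0 -> {morph f : z w / z + w} -> (forall z a, f (z * RtoC a) = f z * a) ->
  u *m cmx M = RtoC lambda *: u -> u *m cmx h = 0 -> forall i, f (u 0 i) = 0.
Proof.
move=> f0 fD fM uM uh i.
suff : \row_j f (u 0 j) = 0 by move=> /rowP/(_ i); rewrite !mxE.
apply: simple.
  apply/rowP => j; have /rowP/(_ j) := uM; rewrite !mxE => /(congr1 f).
  rewrite (big_morph f fD f0) mulrC fM mulrC => <-.
  by apply: eq_bigr => k _; rewrite !mxE fM.
apply/rowP => j; have /rowP/(_ j) := uh; rewrite !mxE => /(congr1 f).
rewrite (big_morph f fD f0) f0 => e; rewrite -[RHS]e.
by apply: eq_bigr => k _; rewrite !mxE fM.
Qed.

(** By Cayley-Hamilton the product u is a left eigenvector for lambda. As h is an eigenvector of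
    every factor, u h is a multiple of z h = 0, and simplicity gives u = 0. *)
Lemma factors_annihilate (z : 'rV[R]_d) : (0 < d)%N -> z *m h = 0 ->
  cmx z *m factors d.+1 = 0.
Proof.
move=> d0 zh; pose u := cmx z *m factors d.+1.
have CH : \prod_(1 <= i < d.+1) (cmx M - (lam i)%:M) = 0.
  move: (M) lam_char; case: (d) d0 => // d' _ M' ch.
  have := Cayley_Hamilton (cmx M'); rewrite ch rmorph_prod => <-.
  apply: eq_bigr => i _; rewrite rmorphB /= horner_mx_X horner_mx_C //.
have uM : u *m cmx M = RtoC lambda *: u.
  rewrite big_ltn // -/(factors d.+1) -mulmxE in CH.
  have : u *m (cmx M - (lam 1%N)%:M) = 0.
    rewrite /u -mulmxA -factors_comm ?CH ?mulmx0 //.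
    by rewrite mulmxBr mulmxBl scalar_mxC.
  by rewrite mulmxBr mul_mx_scalar lam1 => /eqP; rewrite subr_eq0 => /eqP.
have fh j : exists c, factors j *m cmx h = c *: cmx h.
  rewrite /factors; elim: j => [|j [c IH]].
    by exists 1; rewrite big_geq // -[1]/(1%:M) mul1mx scale1r.
  have [j2|j2] := leqP 2 j; last by exists 1; rewrite big_geq // -[1]/(1%:M) mul1mx scale1r.
  exists ((RtoC lambda - lam j) * c); rewrite -/(factors j.+1) factorsS // -mulmxA.
  rewrite mulmxBl -map_mxM Mh map_mxZ mul_scalar_mx -scalerBl -scalemxAr.
  by rewrite [factors j *m _]IH scalerA.
have uh : u *m cmx h = 0.
  have [c e] := fh d.+1.
  by rewrite /u -mulmxA e -scalemxAr -map_mxM zh map_mx0 scaler0.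
have re0 := real_part_eq0 (f := @complex.Re R) _ _ _ uM uh.
have im0 := real_part_eq0 (f := @complex.Im R) _ _ _ uM uh.
apply/rowP => i; rewrite [RHS]mxE; apply/eqP; rewrite -/u eq_complex /=.
rewrite re0 ?im0 ?eqxx //.
- by move=> [a b] [a' b'].
- by move=> [a b] a' /=; rewrite mulr0 add0r.
- by move=> [a b] [a' b'].
- by move=> [a b] a' /=; rewrite mulr0 subr0.
Qed.

Lemma green_comm_M : G *m M = M *m G.
Proof.
have := mulmx1C MG; rewrite mulmxBr mulmx1 => e1.
have := MG; rewrite mulmxBl mul1mx => e2.
by have /addrI/oppr_inj := etrans e1 (esym e2).
Qed.

Lemma lam_neq1 i : (2 <= i < d.+1)%N -> 1 - lam i != 0.
Proof.
move=> id; rewrite subr_eq0 eq_sym; apply/negP => /eqP li.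
have : eigenvalue (cmx M) (lam i).
  rewrite eigenvalue_root_char lam_char rootE horner_prod.
  rewrite prodf_seq_eq0; apply/hasP; exists i.
    by rewrite mem_index_iota (leq_trans _ (andP id).1) ?(andP id).2.
  by rewrite /= !hornerE subrr.
move=> /eigenvalueP[v vM v0]; case/negP: v0; apply/eqP.
have := congr1 cmx MG; rewrite map_mxM map_mxB !map_mx1 => MGc.
by rewrite -[v]mulmx1 -MGc mulmxA mulmxBr mulmx1 vM li scale1r subrr mul0mx.
Qed.

Definition drift : 'M[R]_d := G - (1 - lambda)^-1%:M.
Definition drift_eigenvalue i : R[i] := 1 / (1 - lam i) - RtoC (1 - lambda)^-1.

(** The identity G - 1/(1 - lam_i) = (M - lam_i) G / (1 - lam_i). Modulo the next factor of the
    chain, the drift thus acts as a scalar, which makes the system triangular. *)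
Lemma factor_drift i : (2 <= i < d.+1)%N ->
  cmx drift = (drift_eigenvalue i)%:M +
    (1 - lam i)^-1 *: ((cmx M - (lam i)%:M) *m cmx G).
Proof.
move=> id; have li := lam_neq1 id.
have l1 : 1 - RtoC lambda != 0.
  by rewrite -(rmorph1 RtoC) -rmorphB fmorph_eq0 subr_eq0 gt_eqF.
have MGc : cmx M *m cmx G = cmx G - 1%:M.
  have := congr1 cmx MG; rewrite map_mxM map_mxB !map_mx1 mulmxBl mul1mx => <-.
  by rewrite opprB addrC subrK.
rewrite /drift map_mxB map_scalar_mx mulmxBl MGc mul_scalar_mx.
apply/matrixP => a b; rewrite !mxE /drift_eigenvalue.
case: (a == b); rewrite ?mulr1n ?mulr0n; field; rewrite ?li //= l1.
Qed.

Lemma linear_recursion_decay (theta kappa T : R) (t : nat -> R) (Z r : nat -> 'rV[R]_d) :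
  (0 < d)%N -> 0 < theta < kappa ->
  (forall n, (0 < n)%N -> 0 <= t n <= T / n%:R) ->
  (forall i, (2 <= i < d.+1)%N -> exists N, forall n, (N <= n)%N ->
     kappa / n%:R <= t n * - complex.Re (drift_eigenvalue i)) ->
  (forall l, small_tails theta (fun n => r n 0 l)) ->
  (forall n, Z n *m h = 0) ->
  (forall n, (0 < n)%N -> Z n.+1 = Z n + t n *: (Z n *m drift) + r n) ->
  forall l, exists L, forall n, (0 < n)%N -> `|Z n 0 l| <= L * decay theta n.
Proof.
move=> d0 thk ht hkappa hr Zh hZ.
(* [k] counts the missing factors: at k = 0 the product annihilates, and at j = 2 it is empty, which
   is the goal. *)
suff H k j : (j + k)%N = d.+1 -> (2 <= j)%N ->
    forall l, decays theta (fun n => (cmx (Z n) *m factors j) 0 l).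
  move=> l; have [|L hL] := H d.-1 2%N _ isT l; first by rewrite addSn add1n prednK.
  exists L => n n0; have := hL n n0.
  by rewrite /factors big_geq // -[1]/(1%:M) mulmx1 mxE cmod_real.
elim: k j => [|k IH] j jk j2 l.
  rewrite addn0 in jk; rewrite jk.
  by apply: eq_decays (decays0 theta) => n; rewrite factors_annihilate // mxE.
have jd : (2 <= j < d.+1)%N by rewrite j2 -jk addnS ltnS leq_addr.
have {}IH := IH j.+1 _ (leqW j2); rewrite addSnnS jk in IH; have {}IH := IH erefl.
pose mu := drift_eigenvalue j.
pose W n := cmx (Z n) *m factors j.+1.
apply: (@perturbed_contraction _ theta kappa mu T t _
   (fun n => \sum_i W n 0 i * (cmx G i l * (1 - lam j)^-1))
   (fun n => \sum_i RtoC (r n 0 i) * factors j i l)) => //.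
- exact: hkappa.
- by apply: decays_sum => i; apply: decaysZ; exact: IH.
- by apply: small_ctails_comb => i; exact: hr.
move=> n n0; rewrite hZ // !map_mxD map_mxZ map_mxM !mulmxDl.
have -> : (RtoC (t n) *: (cmx (Z n) *m cmx drift)) *m factors j =
    RtoC (t n) *: (mu *: (cmx (Z n) *m factors j) +
      (1 - lam j)^-1 *: (W n *m cmx G)).
  rewrite -scalemxAl; congr (_ *: _); rewrite -mulmxA factors_comm; last first.
    rewrite /drift map_mxB map_scalar_mx mulmxBl mulmxBr -!map_mxM green_comm_M.
    by rewrite scalar_mxC.
  rewrite (factor_drift jd) mulmxDr mul_mx_scalar mulmxDr -scalemxAr.
  by rewrite /W factorsS // -!scalemxAr !mulmxA.
set V := cmx (Z n) *m factors j.
rewrite !mxE [in LHS]mulrDr [in RHS]mulrDr mulr1 !addrA; congr (_ + _ + _ + _).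
- by rewrite [RHS]mulrCA [mu * _]mulrC.
- congr (_ * _); rewrite mulr_sumr; apply: eq_bigr => i _.
  by rewrite mulrCA [in RHS](mulrC (cmx G i l)).
by apply: eq_bigr => i _; rewrite mxE.
Qed.

End Factorisation.

(** * Projective coordinates *)

Section Lipschitz.
Context {R : realType} {d : nat}.
Implicit Types (x y : 'rV[R]_d) (f g : 'rV[R]_d -> R).

Definition row_simplex x : Prop := (forall i, 0 <= x 0 i) /\ \sum_i x 0 i = 1.

Definition dist1 x y : R := \sum_i `|x 0 i - y 0 i|.

Lemma dist1_ge0 x y : 0 <= dist1 x y.
Proof. exact: sumr_ge0. Qed.

(** Bound and Lipschitz constant go together so that the class is closed under products; on the
    simplex, inverses of functions bounded below are included. *)
Definition lipschitz_bounded f : Prop := exists2 C, 0 <= C & forall x y,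
  row_simplex x -> row_simplex y -> `|f x| <= C /\ `|f x - f y| <= C * dist1 x y.

Lemma eq_lipb f g : f =1 g -> lipschitz_bounded f -> lipschitz_bounded g.
Proof. by move=> e [C C0 hC]; exists C => // x y; rewrite -!e; exact: hC. Qed.

Lemma lipb_cst c : lipschitz_bounded (fun _ => c).
Proof.
exists `|c| => // x y _ _; split => //.
by rewrite subrr normr0 mulr_ge0 ?dist1_ge0.
Qed.

Lemma lipb_coord i : lipschitz_bounded (fun x => x 0 i).
Proof.
exists 1 => // x y [x0 x1] _; split.
  by rewrite ger0_norm // -x1 (bigD1 i) //= lerDl sumr_ge0.
by rewrite mul1r /dist1 (bigD1 i) //= lerDl sumr_ge0.
Qed.

Lemma lipbD f g : lipschitz_bounded f -> lipschitz_bounded g ->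
  lipschitz_bounded (fun x => f x + g x).
Proof.
move=> [C C0 hC] [D D0 hD]; exists (C + D) => [|x y sx sy]; first exact: addr_ge0.
have [f1 f2] := hC _ _ sx sy; have [g1 g2] := hD _ _ sx sy; split.
  by apply: le_trans (ler_normD _ _) (lerD f1 g1).
have -> : f x + g x - (f y + g y) = (f x - f y) + (g x - g y) by ring.
by rewrite mulrDl; apply: le_trans (ler_normD _ _) (lerD f2 g2).
Qed.

Lemma lipbM f g : lipschitz_bounded f -> lipschitz_bounded g ->
  lipschitz_bounded (fun x => f x * g x).
Proof.
move=> [C C0 hC] [D D0 hD].
exists (C * D + C * D) => [|x y sx sy]; first by rewrite addr_ge0 ?mulr_ge0.
have [f1 f2] := hC _ _ sx sy; have [g1 g2] := hD _ _ sx sy.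
have [f3 _] := hC _ _ sy sx; split.
  by rewrite normrM; apply: le_trans (ler_pM _ _ f1 g1) _; rewrite ?lerDl ?mulr_ge0.
have -> : f x * g x - f y * g y = (f x - f y) * g x + f y * (g x - g y) by ring.
apply: le_trans (ler_normD _ _) _; rewrite !normrM mulrDl; apply: lerD.
  by rewrite mulrAC; apply: ler_pM.
by rewrite -mulrA; apply: ler_pM.
Qed.

Lemma lipbN f : lipschitz_bounded f -> lipschitz_bounded (fun x => - f x).
Proof.
move=> hf; apply: eq_lipb (lipbM (lipb_cst (-1)) hf) => x; exact: mulN1r.
Qed.

Lemma lipb_sum (I : Type) (s : seq I) (F : I -> 'rV[R]_d -> R) :
  (forall i, lipschitz_bounded (F i)) ->
  lipschitz_bounded (fun x => \sum_(i <- s) F i x).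
Proof.
move=> hF; elim: s => [|i s IH].
  by apply: eq_lipb (lipb_cst 0) => x; rewrite big_nil.
by apply: eq_lipb (lipbD (hF i) IH) => x; rewrite big_cons.
Qed.

Lemma lipbV f c : 0 < c -> (forall x, row_simplex x -> c <= f x) ->
  lipschitz_bounded f -> lipschitz_bounded (fun x => (f x)^-1).
Proof.
move=> c0 hc [C C0 hC].
exists (c^-1 + C * c^-1 ^+ 2) => [|x y sx sy].
  by rewrite addr_ge0 ?mulr_ge0 ?sqr_ge0 ?invr_ge0 // ltW.
have [f1 f2] := hC _ _ sx sy.
have fx : 0 < f x by apply: lt_le_trans (hc _ sx).
have fy : 0 < f y by apply: lt_le_trans (hc _ sy).
have ix : (f x)^-1 <= c^-1 by rewrite lef_pV2 ?posrE // hc.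
have iy : (f y)^-1 <= c^-1 by rewrite lef_pV2 ?posrE // hc.
have ix0 : 0 <= (f x)^-1 by rewrite invr_ge0 ltW.
have iy0 : 0 <= (f y)^-1 by rewrite invr_ge0 ltW.
split.
  by rewrite ger0_norm //; apply: le_trans ix _; rewrite lerDl mulr_ge0 ?sqr_ge0.
have -> : (f x)^-1 - (f y)^-1 = - (f x - f y) * ((f x)^-1 * (f y)^-1).
  by field; rewrite !gt_eqF.
rewrite normrM normrN (ger0_norm (mulr_ge0 ix0 iy0)).
apply: le_trans (_ : (C * dist1 x y) * (c^-1 ^+ 2) <= _).
  by apply: ler_pM => //; rewrite ?mulr_ge0 // expr2 ler_pM.
rewrite mulrAC ler_wpM2r ?dist1_ge0 // lerDr invr_ge0; exact: ltW.
Qed.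

End Lipschitz.

Section ProjectiveDynamics.
Context {R : realType} {d : nat} (M G : 'M[R]_d) (lambda : R) (h : 'cV[R]_d)
  (nu : 'rV[R]_d).
Hypothesis lambda1 : lambda < 1.
Hypothesis h_gt0 : forall i, 0 < h i 0.
Hypothesis Mh : M *m h = lambda *: h.
Hypothesis Gh : G *m h = (1 - lambda)^-1 *: h.
Hypothesis MG : (1%:M - M) *m G = 1%:M.
Hypothesis nuG : nu *m G = (1 - lambda)^-1 *: nu.
Hypothesis nuh : nu *m h = 1%:M.
Hypothesis nu_simplex : row_simplex nu.
Hypothesis G1 : forall i, 1 <= (G *m const_mx 1 : 'cV_d) i 0.
Implicit Types (x : 'rV[R]_d) (i j l : 'I_d).

Let one : 'cV[R]_d := const_mx 1.
Let B : 'M[R]_d := drift G lambda.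

Definition mass x : R := (x *m h) 0 0.
Definition proj x : 'rV[R]_d := (mass x)^-1 *: x.
Definition lifetime x : R := (x *m (G *m one)) 0 0.
Definition speed x : R := (lifetime x)^-1.
Definition unit_row i : 'rV[R]_d := delta_mx 0 i.
Definition exit_prob i : R := 1 - (unit_row i *m M *m one) 0 0.
Definition next_law x i : 'rV[R]_d := unit_row i *m M + exit_prob i *: x.
(** The matrix Q multiplied by [G] is the displacement field, one row per state, minus its mean
    under x G / (x G 1), the invariant law of K[x]. Now 1 - K[x] is 1 - M minus the column of exit
    probabilities times x, and x G Q = 0 by centring; so G Q solves (1 - K[x]) c = Q. *)
Definition corrector x : 'M[R]_d := G *m
  ((mass x)^-1 *: (1%:M - h *m proj x) - speed x *: (one *m (proj x *m B))).

Lemma simplex_dim x : row_simplex x -> exists i : 'I_d, true.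
Proof.
move=> [_ x1]; apply: contrapT => nex; move: x1; rewrite big1 => [/eqP|i].
  by rewrite eq_sym oner_eq0.
by case: nex; exists i.
Qed.

Lemma weighted_bounds x (c : 'cV[R]_d) m0 : row_simplex x ->
  (forall i, m0 <= c i 0) -> (forall i, 0 <= c i 0) ->
  m0 <= (x *m c) 0 0 <= \sum_i c i 0.
Proof.
move=> [x0 x1] hm c0; rewrite mxE; apply/andP; split.
  by rewrite -[leLHS]mul1r -x1 mulr_suml; apply: ler_sum => i _; rewrite ler_wpM2l.
apply: ler_sum => i _; rewrite ler_piMl //.
by rewrite -x1 (bigD1 i) //= lerDl sumr_ge0.
Qed.

Lemma h_min : exists2 m0, 0 < m0 & forall i, m0 <= h i 0.
Proof.
have [i0 _] := simplex_dim nu_simplex.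
pose k := [arg min_(j < i0) (h j 0)]%O.
by exists (h k 0) => // i; rewrite /k; case: arg_minP => // m _; exact.
Qed.

Lemma mass_gt0 x : row_simplex x -> 0 < mass x.
Proof.
move=> sx; have [m0 m00 hm] := h_min; apply: lt_le_trans m00 _.
by have /andP[] := weighted_bounds sx hm (fun i => ltW (h_gt0 i)).
Qed.

Lemma lifetime_bounds x : row_simplex x ->
  1 <= lifetime x <= \sum_i (G *m one) i 0.
Proof. by move=> sx; apply: weighted_bounds => // i; apply: le_trans (G1 i). Qed.

Lemma lifetime_gt0 x : row_simplex x -> 0 < lifetime x.
Proof. by move=> sx; have /andP[+ _] := lifetime_bounds sx; apply: lt_le_trans. Qed.

Lemma lipb_mulmx n (c : 'M[R]_(d, n)) (j : 'I_n) : lipschitz_bounded (fun x => (x *m c) 0 j).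
Proof.
apply: (@eq_lipb _ _ (fun x => \sum_i x 0 i * c i j)) => [x|]; first by rewrite mxE.
by apply: lipb_sum => i; apply: lipbM; [exact: lipb_coord|exact: lipb_cst].
Qed.

Lemma lipb_massV : lipschitz_bounded (fun x => (mass x)^-1).
Proof.
have [m0 m00 hm] := h_min; apply: (lipbV m00) => [x sx|]; last exact: lipb_mulmx.
by have /andP[] := weighted_bounds sx hm (fun i => ltW (h_gt0 i)).
Qed.

Lemma lipb_speed : lipschitz_bounded speed.
Proof.
apply: (@lipbV _ _ _ 1) => // [x sx|]; last exact: lipb_mulmx.
by have /andP[] := lifetime_bounds sx.
Qed.

Lemma lipb_proj l : lipschitz_bounded (fun x => proj x 0 l).
Proof.
apply: (@eq_lipb _ _ (fun x => (mass x)^-1 * x 0 l)) => [x|]; first by rewrite mxE.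
by apply: lipbM; [exact: lipb_massV|exact: lipb_coord].
Qed.

Lemma lipb_proj_mul (N : 'M[R]_d) l : lipschitz_bounded (fun x => (proj x *m N) 0 l).
Proof.
apply: (@eq_lipb _ _ (fun x => \sum_i proj x 0 i * N i l)) => [x|].
  by rewrite [RHS]mxE.
by apply: lipb_sum => i; apply: lipbM; [exact: lipb_proj|exact: lipb_cst].
Qed.

Lemma lipb_velocity l : lipschitz_bounded (fun x => (speed x *: (proj x *m B)) 0 l).
Proof.
apply: (@eq_lipb _ _ (fun x => speed x * (proj x *m B) 0 l)) => [x|].
  by rewrite [RHS]mxE.
by apply: lipbM; [exact: lipb_speed|exact: lipb_proj_mul].
Qed.

Lemma lipb_corrector i l : lipschitz_bounded (fun x => corrector x i l).
Proof.
pose q k := fun x => (mass x)^-1 * ((k == l)%:R - h k 0 * proj x 0 l)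
  + - (speed x * (proj x *m B) 0 l).
apply: (@eq_lipb _ _ (fun x => \sum_k G i k * q k x)) => [x|].
  rewrite [RHS]mxE; apply: eq_bigr => k _; congr (_ * _); rewrite /q.
  have <- : (h *m proj x) k l = h k 0 * proj x 0 l by rewrite mxE big_ord1.
  have <- : (one *m (proj x *m B)) k l = (proj x *m B) 0 l.
    by rewrite mxE big_ord1 mxE mul1r.
  by rewrite !mxE.
apply: lipb_sum => k; apply: lipbM; first exact: lipb_cst.
apply: lipbD.
  apply: lipbM; first exact: lipb_massV.
  apply: lipbD; first exact: lipb_cst.
  by apply: lipbN; apply: lipbM; [exact: lipb_cst|exact: lipb_proj].
by apply: lipbN; apply: lipbM; [exact: lipb_speed|exact: lipb_proj_mul].
Qed.

Lemma nu_drift : nu *m B = 0.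
Proof. by rewrite /B /drift mulmxBr nuG mul_mx_scalar subrr. Qed.

(* The left-hand side drives the projective coordinates.  Its average under the
   invariant law of the kernel frozen at x is the first term on the right, and
   the corrector solves the Poisson equation for the difference. *)
Lemma poisson x i : 0 < mass x -> 0 < lifetime x ->
  (mass x)^-1 *: (unit_row i - h i 0 *: proj x) =
  speed x *: (proj x *m B) + (unit_row i - next_law x i) *m corrector x.
Proof.
move=> a0 t0; set a := mass x in a0 *; set e := unit_row i; set p := exit_prob i.
have an0 : a != 0 by rewrite gt_eqF.
have tn0 : lifetime x != 0 by rewrite gt_eqF.
have l0 : 1 - lambda != 0 by rewrite subr_eq0 gt_eqF.
pose N := e - p *: (x *m G).
have NE : (e - next_law x i) *m G = N.
  have := mulmx1C MG => _; rewrite /N /next_law -/e -/p opprD addrA.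
  have -> : e - e *m M = e *m (1%:M - M) by rewrite mulmxBr mulmx1.
  by rewrite mulmxBl -mulmxA MG mulmx1 scalemxAl.
rewrite /corrector mulmxA NE -/a.
have eh : e *m h = (h i 0)%:M by rewrite -rowE; apply/matrixP => u v; rewrite !ord1 !mxE mulr1n.
have xh : x *m h = a%:M.
  by apply/matrixP => u v; rewrite !ord1 [RHS]mxE mulr1n.
have Nh : N *m h = (h i 0 - p * (a / (1 - lambda)))%:M.
  rewrite mulmxBl eh -scalemxAl -mulmxA Gh -scalemxAr xh.
  by apply/matrixP => u v; rewrite !ord1 !mxE !mulr1n; ring.
have e1 : e *m one = 1%:M.
  by rewrite -rowE; apply/matrixP => u v; rewrite !ord1 !mxE.
have xG1 : x *m G *m one = (lifetime x)%:M.
  by rewrite -mulmxA; apply/matrixP => u v; rewrite !ord1 [RHS]mxE mulr1n.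
have N1 : N *m one = (1 - p * lifetime x)%:M.
  rewrite mulmxBl e1 -scalemxAl xG1.
  by apply/matrixP => u v; rewrite !ord1 !mxE !mulr1n; ring.
have yB : proj x *m B = a^-1 *: (x *m G) - (1 - lambda)^-1 *: proj x.
  by rewrite /B /drift mulmxBr mul_mx_scalar /proj -/a -scalemxAl.
have expand (y w : 'rV[R]_d) (s : R) :
    N *m (a^-1 *: (1%:M - h *m y) - s *: (one *m w)) =
    a^-1 *: (N - (h i 0 - p * (a / (1 - lambda))) *: y) - s *: ((1 - p * lifetime x) *: w).
  by rewrite mulmxBr -!scalemxAr mulmxBr mulmx1 !mulmxA Nh N1 !mul_scalar_mx.
rewrite expand yB /speed /N /proj -/a; apply/rowP => k; rewrite !mxE.
by field; rewrite an0 tn0 l0.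
Qed.

(** The formula has no second-order error; the price is the new mass in front of the old
    projection. *)
Lemma proj_step x i g : 0 < mass x -> 0 < mass ((1 - g) *: x + g *: unit_row i) ->
  let x' := (1 - g) *: x + g *: unit_row i in
  proj x' - proj x = (g / mass x') *: (unit_row i - h i 0 *: proj x).
Proof.
move=> a0 a'0 /=; set x' := _ + _ in a'0 *.
have a' : mass x' = (1 - g) * mass x + g * h i 0.
  rewrite /mass /x' mulmxDl -!scalemxAl mxE; congr (_ + _); first by rewrite mxE.
  by rewrite mxE -rowE mxE.
have an0 : mass x != 0 by rewrite gt_eqF.
have a'n0 : mass x' != 0 by rewrite gt_eqF.
move: a'n0; rewrite /proj a' /x' => a'n0.
by apply/rowP => k; rewrite !mxE; field; rewrite an0 a'n0.
Qed.

Lemma proj_orthogonal x : 0 < mass x -> (proj x - nu) *m h = 0.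
Proof.
move=> a0; rewrite mulmxBl nuh /proj -scalemxAl; apply/matrixP => u v.
by rewrite !ord1 2!mxE -/(mass x) mulVf ?gt_eqF // !mxE subrr.
Qed.

(** Inverts the projection: with z = proj x - nu, the sum of z is 1/mass x - 1, whence x - nu = mass
    x (z - (sum of z) nu). *)
Lemma coordinate_from_proj x l : row_simplex x ->
  `|x 0 l - nu 0 l| <= (\sum_i h i 0) *
     (`|(proj x - nu) 0 l| + \sum_k `|(proj x - nu) 0 k|).
Proof.
move=> sx; have a0 := mass_gt0 sx; have an0 : mass x != 0 by rewrite gt_eqF.
have al : mass x <= \sum_i h i 0.
  have [m0 m00 hm] := h_min.
  by have /andP[] := weighted_bounds sx hm (fun i => ltW (h_gt0 i)).
have [nu0 nu1] := nu_simplex; have [x0 x1] := sx.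
have -> : x 0 l - nu 0 l = mass x *
    ((proj x - nu) 0 l - (\sum_k (proj x - nu) 0 k) * nu 0 l).
  have -> : \sum_k (proj x - nu) 0 k = (mass x)^-1 - 1.
    under eq_bigr do rewrite !mxE.
    by rewrite big_split sumrN /= nu1 -mulr_sumr x1 mulr1.
  by rewrite !mxE; field.
rewrite normrM (ger0_norm (ltW a0)); apply: ler_pM => //; first exact: ltW.
apply: le_trans (ler_normB _ _) _; rewrite lerD2l normrM.
rewrite -[leRHS]mulr1; apply: ler_pM => //; first exact: ler_norm_sum.
by rewrite ger0_norm // -nu1 (bigD1 l) //= lerDl sumr_ge0.
Qed.

Lemma speed_nu : speed nu = 1 - lambda.
Proof.
rewrite /speed /lifetime mulmxA nuG -scalemxAl !mxE.
under eq_bigr do rewrite mxE mulr1.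
by rewrite nu_simplex.2 mulr1 invrK.
Qed.

(** * Decay along one fixed trajectory *)

Section Trajectory.
Variables (x : nat -> 'rV[R]_d) (X : nat -> 'I_d) (gamma : nat -> R) (Gamma : R).
Hypothesis x_simplex : forall n, row_simplex (x n).
Hypothesis gamma01 : forall n, 0 < gamma n < 1.
Hypothesis gamma_dec : nonincreasing_seq gamma.
Hypothesis gamma_le : forall n, (0 < n)%N -> gamma n <= Gamma / n%:R.
Hypothesis x_rec : forall n,
  x n.+1 = (1 - gamma n) *: x n + gamma n *: unit_row (X n.+1).
Implicit Types n : nat.

Lemma gamma_ge0 n : 0 <= gamma n.
Proof. by have /andP[/ltW] := gamma01 n. Qed.

Lemma gamma_sqr n : (0 < n)%N -> gamma n * gamma n <= Gamma ^+ 2 * n%:R^-1 ^+ 2.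
Proof.
by move=> n0; rewrite -exprMn expr2; apply: ler_pM; rewrite ?gamma_ge0 ?gamma_le.
Qed.

Lemma dist1_step n : dist1 (x n.+1) (x n) <= 2 * gamma n.
Proof.
have [x0 x1] := x_simplex n.
apply: le_trans (_ : \sum_i (gamma n * (unit_row (X n.+1) 0 i + x n 0 i)) <= _).
  apply: ler_sum => i _; rewrite x_rec !mxE.
  set e : R := (_ && _)%:R.
  have -> : (1 - gamma n) * x n 0 i + gamma n * e - x n 0 i =
    gamma n * (e - x n 0 i) by ring.
  rewrite normrM ger0_norm ?gamma_ge0 // ler_wpM2l ?gamma_ge0 //.
  by apply: le_trans (ler_normB _ _) _; rewrite !ger0_norm // /e ler0n.
rewrite -mulr_sumr mulrC ler_wpM2r ?gamma_ge0 // big_split /= x1 (bigD1 (X n.+1)) //=.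
rewrite mxE !eqxx big1 => [|i ij]; first by rewrite /= addr0; lra.
by rewrite mxE (negbTE ij).
Qed.

Lemma lipb_step f : lipschitz_bounded f -> exists2 C, 0 <= C & forall n,
  `|f (x n)| <= C /\ `|f (x n.+1) - f (x n)| <= C * gamma n.
Proof.
move=> [C C0 hC]; exists (2 * C) => [|n]; first exact: mulr_ge0.
have [h1 _] := hC _ _ (x_simplex n) (x_simplex n).
have [_ h2] := hC _ _ (x_simplex n.+1) (x_simplex n); split.
  by apply: le_trans h1 _; rewrite ler_peMl // ler1n.
by apply: le_trans h2 _; rewrite [2 * C]mulrC -mulrA ler_wpM2l ?dist1_step.
Qed.

Definition velocity y : 'rV[R]_d := speed y *: (proj y *m B).
(** The step from n to n+1 is driven by X_{n+1}, and the Poisson equation at that state brings in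
    its successor; so the increment is centred given the history up to n+1. *)
Definition noise n : 'rV[R]_d :=
  (unit_row (X n.+2) - next_law (x n.+1) (X n.+1)) *m corrector (x n.+1).
Definition remainder n : 'rV[R]_d :=
  proj (x n.+1) - proj (x n) - gamma n *: velocity (x n).

(** The first and last terms come from moving the velocity and the projection from x_n to x_{n+1},
    and are O(gamma_n^2). The third is kept as a sum over states so that each state telescopes with
    a slowly varying weight. *)
Lemma remainderE n l : remainder n 0 l =
  gamma n * (velocity (x n.+1) 0 l - velocity (x n) 0 l)
  + gamma n * noise n 0 l
  + - 1 * (\sum_i gamma n * corrector (x n.+1) i l *
       (unit_row (X n.+2) 0 i - unit_row (X n.+1) 0 i))
  + gamma n * ((mass (x n.+1))^-1 * h (X n.+1) 0 *
       (proj (x n.+1) 0 l - proj (x n) 0 l)).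
Proof.
have a0 := mass_gt0 (x_simplex n); have a'0 := mass_gt0 (x_simplex n.+1).
have e1 : proj (x n.+1) - proj (x n) = (gamma n / mass (x n.+1)) *:
    (unit_row (X n.+1) - h (X n.+1) 0 *: proj (x n)).
  by rewrite {1 2}x_rec; apply: proj_step => //; rewrite -x_rec.
have e2 := poisson (X n.+1) a'0 (lifetime_gt0 (x_simplex n.+1)).
have -> : \sum_i gamma n * corrector (x n.+1) i l *
       (unit_row (X n.+2) 0 i - unit_row (X n.+1) 0 i) =
   gamma n * ((unit_row (X n.+2) - unit_row (X n.+1)) *m corrector (x n.+1)) 0 l.
  rewrite mxE mulr_sumr; apply: eq_bigr => i _.
  rewrite -mulrA; congr (_ * _); rewrite mulrC; congr (_ * _).
  by rewrite !mxE.
have e3 : (unit_row (X n.+1) - next_law (x n.+1) (X n.+1)) *m corrector (x n.+1) =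
   noise n - (unit_row (X n.+2) - unit_row (X n.+1)) *m corrector (x n.+1).
  by rewrite /noise -mulmxBl; congr (_ *m _); rewrite opprB [RHS]addrC addrA subrK.
rewrite e3 -/(velocity _) in e2.
have e4 : (unit_row (X n.+1) - h (X n.+1) 0 *: proj (x n)) =
   (unit_row (X n.+1) - h (X n.+1) 0 *: proj (x n.+1)) +
   h (X n.+1) 0 *: (proj (x n.+1) - proj (x n)).
  by rewrite scalerBr addrA subrK.
have e5 : remainder n = gamma n *: (velocity (x n.+1) - velocity (x n)) +
   gamma n *: noise n
   - gamma n *: ((unit_row (X n.+2) - unit_row (X n.+1)) *m corrector (x n.+1))
   + gamma n *: (((mass (x n.+1))^-1 * h (X n.+1) 0) *: (proj (x n.+1) - proj (x n))).
  rewrite /remainder {1}e1 e4 -scalerA scalerDr e2 scalerA.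
  by rewrite !scalerDr !scalerN !addrA; apply/rowP => k; rewrite !mxE; ring.
rewrite e5; move: (velocity _) (velocity _) (noise n) (_ *m corrector _) => v1 v2 w c.
by rewrite !mxE; ring.
Qed.

Lemma remainder_tails theta l : 0 < theta <= 1 ->
  (forall k, small_tails theta (fun n => gamma n * noise n 0 k)) ->
  small_tails theta (fun n => remainder n 0 l).
Proof.
move=> t01 hnoise.
apply: (eq_small_tails (fun n _ => esym (remainderE n l))).
apply: small_tailsD; first apply: small_tailsD; first apply: small_tailsD.
- have [C C0 hC] := lipb_step (lipb_velocity l).
  apply: (@small_tails_sqr _ _ (C * Gamma ^+ 2)) => // n n0.
  rewrite normrM ger0_norm ?gamma_ge0 //.
  apply: le_trans (_ : C * (gamma n * gamma n) <= _).
    by rewrite mulrCA ler_wpM2l ?gamma_ge0 // (hC n).2.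
  by rewrite -mulrA ler_wpM2l // gamma_sqr.
- exact: hnoise.
- apply: small_tailsZ; apply: small_tails_sum => i.
  have [C C0 hC] := lipb_step (lipb_corrector i l).
  apply: (@small_tails_telescope _ theta gamma (fun n => corrector (x n.+1) i l)
    (fun n => unit_row (X n.+1) 0 i) Gamma C 1) => //.
  + exact: gamma_ge0.
  + by move=> n; exact: (hC n.+1).1.
  + by move=> n; apply: le_trans (hC n.+1).2 _; rewrite ler_wpM2l //; apply: gamma_dec.
  + by move=> n; rewrite mxE; case: (_ && _); rewrite ?normr1 ?normr0.
have [C C0 hC] := lipb_step lipb_massV.
have [D D0 hD] := lipb_step (lipb_proj l).
have H0 : 0 <= \sum_i h i 0 by apply: sumr_ge0 => i _; exact: ltW.
apply: (@small_tails_sqr _ _ (C * (\sum_i h i 0) * D * Gamma ^+ 2)) => // n n0.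
rewrite !normrM (ger0_norm (gamma_ge0 n)).
apply: le_trans (_ : gamma n * (C * (\sum_i h i 0) * (D * gamma n)) <= _).
  rewrite ler_wpM2l ?gamma_ge0 //; apply: ler_pM => //.
  - apply: ler_pM => //; first exact: (hC n.+1).1.
    rewrite (ger0_norm (ltW (h_gt0 _))) (bigD1 (X n.+1)) //= lerDl.
    by apply: sumr_ge0 => i _; exact: ltW.
  - exact: (hD n).2.
have -> : gamma n * (C * (\sum_i h i 0) * (D * gamma n)) =
  C * (\sum_i h i 0) * D * (gamma n * gamma n) by ring.
by rewrite -[leRHS]mulrA ler_wpM2l ?gamma_sqr // !mulr_ge0.
Qed.

Variable lam : nat -> R[i].
Hypothesis lam_char : char_poly (map_mx (real_complex R) M) =
  \prod_(1 <= i < d.+1) ('X - (lam i)%:P).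
Hypothesis lam1 : lam 1%N = real_complex R lambda.
Hypothesis simple : forall u : 'rV[R]_d, u *m M = lambda *: u -> u *m h = 0 -> u = 0.

(** The lower bound on the effective step is left abstract, so as to accept first the crude bound on
    the clock and then its value near nu. *)
Lemma decay_from_speed (theta kappa rho : R) : 0 < theta <= 1 -> theta < kappa -> 0 <= rho ->
  (forall k, small_tails theta (fun n => gamma n * noise n 0 k)) ->
  (forall i : nat, (2 <= i < d.+1)%N ->
     rho <= - complex.Re (drift_eigenvalue lambda lam i)) ->
  (exists N, forall n, (N <= n)%N -> kappa / n%:R <= gamma n * speed (x n) * rho) ->
  exists L, forall n, (0 < n)%N -> dist1 (x n) nu <= L * decay theta n.
Proof.
move=> t01 tk rho0 hnoise hrho [N hN]; have /andP[t0 t1] := t01.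
have d0 : (0 < d)%N by have [[]] := simplex_dim nu_simplex; case: (d).
have sp0 n : 0 <= speed (x n) by rewrite invr_ge0 ltW // lifetime_gt0.
have sp1 n : speed (x n) <= 1.
  rewrite invf_le1 ?lifetime_gt0 //.
  by have /andP[] := lifetime_bounds (x_simplex n).
have H l : exists L, forall n, (0 < n)%N ->
    `|(proj (x n) - nu) 0 l| <= L * decay theta n.
  apply: (@linear_recursion_decay _ _ M G lambda h lam _ _ _ _ _ _
    theta kappa Gamma (fun n => gamma n * speed (x n))
    (fun n => proj (x n) - nu) remainder) => //.
  - by rewrite t0.
  - move=> n n0; rewrite mulr_ge0 ?gamma_ge0 //=.
    by apply: le_trans (gamma_le n0); rewrite ler_piMr ?gamma_ge0.
  - move=> i id; exists N => n Nn; apply: le_trans (hN n Nn) _.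
    apply: ler_wpM2l; [apply: mulr_ge0; [exact: gamma_ge0|exact: sp0]|exact: hrho].
  - by move=> k; apply: remainder_tails.
  - by move=> n; apply: proj_orthogonal; exact: mass_gt0.
  move=> n _; rewrite [X in _ *: X]mulmxBl nu_drift subr0 -scalerA -/(velocity _).
  by rewrite /remainder; apply/rowP => k; rewrite !mxE; ring.
have {H} [L hL] := choice H.
pose Ls := \sum_k L k.
have hs : 0 <= \sum_i h i 0 by apply: sumr_ge0 => i _; exact: ltW.
exists (\sum_l (\sum_i h i 0) * (L l + Ls)) => n n0.
rewrite /dist1 mulr_suml; apply: ler_sum => l _.
apply: le_trans (coordinate_from_proj l (x_simplex n)) _.
rewrite -mulrA ler_wpM2l // mulrDl lerD ?hL // /Ls mulr_suml.
by apply: ler_sum => k _; exact: hL.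
Qed.

Lemma trajectory_decay (theta A rate : R) : 0 < theta <= 1 -> 0 < A -> 0 < rate ->
  theta < rate * A ->
  (forall k, small_tails theta (fun n => gamma n * noise n 0 k)) ->
  (forall i : nat, (2 <= i < d.+1)%N ->
     rate / (1 - lambda) <= - complex.Re (drift_eigenvalue lambda lam i)) ->
  (forall A' : R, A' < A -> exists N, forall n, (N <= n)%N -> A' / n%:R <= gamma n) ->
  exists L, forall n, (0 < n)%N -> dist1 (x n) nu <= L * decay theta n.
Proof.
move=> t01 A0 rate0 trA hnoise hrho hA; have /andP[t0 t1] := t01.
have l0 : 0 < 1 - lambda by rewrite subr_gt0.
pose rho := rate / (1 - lambda).
have rho0 : 0 < rho by exact: divr_gt0.
pose U := \sum_i (G *m one) i 0.
have sp n : U^-1 <= speed (x n).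
  rewrite lef_pV2 ?posrE ?lifetime_gt0 //; first by have /andP[] := lifetime_bounds (x_simplex n).
  by apply: lt_le_trans (lifetime_gt0 nu_simplex) _; have /andP[] := lifetime_bounds nu_simplex.
have U0 : 0 < U^-1.
  rewrite invr_gt0; apply: lt_le_trans (lifetime_gt0 nu_simplex) _.
  by have /andP[] := lifetime_bounds nu_simplex.
(* [U] bounds every lifetime; A/2 is used because gamma_n >= A'/n is available only for A' < A. *)
pose kap0 := A / 2 * U^-1 * rho.
have kap00 : 0 < kap0 by rewrite !mulr_gt0 // invr_gt0.
pose th0 := Num.min theta (kap0 / 2).
have th00 : 0 < th0 by rewrite lt_min t0 divr_gt0.
have th0t : th0 <= theta by rewrite ge_min lexx.
have [|||k|i id||L hL] := @decay_from_speed th0 kap0 rho.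
- by rewrite th00 (le_trans th0t).
- by apply: le_lt_trans (_ : kap0 / 2 < _); rewrite ?ge_min ?lexx ?orbT //; lra.
- exact: ltW.
- exact: small_tails_weaken th0t (hnoise k).
- exact: hrho.
- have [|N hN] := hA (A / 2); first lra.
  exists N => n Nn; have -> : kap0 / n%:R = A / 2 / n%:R * U^-1 * rho.
    by rewrite /kap0; ring.
  rewrite ler_wpM2r ?(ltW rho0) //; apply: ler_pM; rewrite ?hN ?(ltW U0) //.
  by rewrite !divr_ge0 // ltW.
(* x tends to nu, hence the speed to its value 1 - lambda at nu. *)
have rA : 0 < rate * A by exact: mulr_gt0.
(* The midpoint of theta and R A is m R A. The clock and the step size each lose a factor q = (1 +
   m)/2, and q^2 >= m. *)
pose m := (theta + rate * A) / 2 / (rate * A).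
have m1 : m < 1 by rewrite ltr_pdivrMr // mul1r; lra.
have m0 : 0 < m by rewrite !divr_gt0 // addr_gt0.
pose q := (1 + m) / 2.
have q1 : q < 1 by rewrite /q; lra.
have q0 : 0 < q by rewrite /q; lra.
have qq : (theta + rate * A) / 2 <= q * q * (rate * A).
  by rewrite -ler_pdivrMr // -/m /q; have := sqr_ge0 (1 - m); lra.
have [C C0 hC] := lipb_speed.
have [|N1 hN1] := @decay_small R th0 ((1 - q) * (1 - lambda) / (C * `|L| + 1)) th00.
  by rewrite divr_gt0 ?mulr_gt0 ?subr_gt0 // ltr_wpDl // mulr_ge0.
have [|N2 hN2] := hA (A * q); first by rewrite gtr_pMr.
apply: (@decay_from_speed theta ((theta + rate * A) / 2) rho) => //.
- lra.
- exact: ltW.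
exists (maxn 1 (maxn N1 N2)) => n; rewrite !geq_max => /andP[n0 /andP[n1 n2]].
have hs : q * (1 - lambda) <= speed (x n).
  have [_] := hC _ _ (x_simplex n) nu_simplex; rewrite speed_nu => h1.
  have h2 : C * dist1 (x n) nu <= C * `|L| * decay th0 n.
    rewrite -mulrA ler_wpM2l //; apply: le_trans (hL n n0) _.
    by rewrite ler_wpM2r ?decay_ge0 // ler_norm.
  have h3 : C * `|L| * decay th0 n <= (1 - q) * (1 - lambda).
    apply: le_trans (_ : (C * `|L| + 1) * decay th0 n <= _).
      by rewrite ler_wpM2r ?decay_ge0 // lerDl.
    rewrite mulrC -ler_pdivlMr ?hN1 // ltr_wpDl // mulr_ge0 //.
  have := ler_norm (- (speed (x n) - (1 - lambda))); rewrite normrN; lra.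
have gn := hN2 n n2.
apply: le_trans (_ : (A * q / n%:R) * (q * (1 - lambda)) * rho <= _).
  have -> : A * q / n%:R * (q * (1 - lambda)) * rho = q * q * (rate * A) / n%:R.
    have nn : n%:R != 0 :> R by rewrite pnatr_eq0 -lt0n.
    by rewrite /rho; field; rewrite nn gt_eqF.
  by rewrite ler_wpM2r ?invr_ge0.
rewrite ler_wpM2r ?(ltW rho0) //; apply: ler_pM => //.
  by rewrite divr_ge0 // mulr_ge0 // ltW.
by rewrite mulr_ge0 // ltW.
Qed.

End Trajectory.
End ProjectiveDynamics.

(** * Step sizes *)

Section StepSizes.
Context {R : realType} (A : R).
Hypothesis A_gt0 : 0 < A.
Implicit Types n k : nat.

Let P n : R := n%:R `^ A.

(** Compares the weight (n+1)^(A-1) with an increment of n^A. Going through the logarithm treats A <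
    1 and A > 1 alike; the 2 is n + 1 <= 2 n. *)
Lemma powR_incr n : (0 < n)%N ->
  A / (1 + A / n.+1%:R) * (P n.+1 / n.+1%:R) <= P n.+1 - P n <=
  2 * A * (P n.+1 / n.+1%:R).
Proof.
move=> n0; have n0' : 0 < n%:R :> R by rewrite ltr0n.
have n1' : 0 < n.+1%:R :> R by rewrite ltr0n.
have [l1 l2] := @ln_succ_bounds R _ n0.
have An : 0 < A / n.+1%:R by rewrite divr_gt0.
have PE k : P k = decay (- A) k by rewrite /decay opprK.
have -> : P n = P n.+1 * expR (- (A * (ln n.+1%:R - ln n%:R))).
  by rewrite !PE !decayE // -expRD; congr expR; ring.
set e := expR _; have -> : P n.+1 - P n.+1 * e = P n.+1 * (1 - e) by ring.
have P0 : 0 <= P n.+1 by exact: powR_ge0.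
rewrite !mulrA ![_ * P n.+1]mulrC -!mulrA; apply/andP; split; apply: ler_wpM2l => //.
  have he : e <= (1 + A / n.+1%:R)^-1.
    rewrite /e expRN lef_pV2 ?posrE ?expR_gt0 ?addr_gt0 //.
    apply: le_trans (expR_ge1Dx _); rewrite lerD2l ler_wpM2l // ltW //.
  have -> : A * ((1 + A / n.+1%:R)^-1 * n.+1%:R^-1) = 1 - (1 + A / n.+1%:R)^-1.
    by move: n1'; set q := n.+1%:R => q0; field; rewrite !gt_eqF // addr_gt0.
  lra.
have he : 1 - A / n%:R <= e.
  apply: le_trans (expR_ge1Dx _); rewrite lerD2l lerN2 ler_wpM2l // ltW //.
apply: le_trans (_ : A / n%:R <= _); first lra.
rewrite mulrCA ler_wpM2l ?(ltW A_gt0) // ler_pdivlMr // mulrC ler_pdivrMr //.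
by rewrite -natrM ler_nat mul2n -addnn -addn1 leq_add2l.
Qed.

Lemma stepsize_bounds (gamma : nat -> R) :
  (forall n, 0 < gamma n < 1) ->
  ((\forall n \near \oo, gamma n = A / n%:R) \/
   (exists omega : nat -> R,
      [/\ forall n, 0 < omega n,
          forall n, (1 <= n)%N -> omega n = n%:R `^ (A - 1) &
          forall n, gamma n = omega n.+1 / \sum_(0 <= i < n.+2) omega i])) ->
  (exists Gamma, forall n, (0 < n)%N -> gamma n <= Gamma / n%:R) /\
  (forall A', A' < A -> exists N, forall n, (N <= n)%N -> A' / n%:R <= gamma n).
Proof.
move=> g01 [[N _ hN]|[omega [om0 omE gE]]].
  split.
    exists (A + N%:R) => n n0; have n0' : 0 < n%:R :> R by rewrite ltr0n.
    have [Nn|nN] := leqP N n; first by rewrite hN // ler_pM2r ?invr_gt0 // lerDl.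
    have /andP[_ /ltW g1] := g01 n; apply: le_trans g1 _.
    rewrite ler_pdivlMr // mul1r; apply: le_trans (_ : N%:R <= _).
      by rewrite ler_nat ltnW.
    by rewrite lerDr ltW.
  by move=> A' A'A; exists N => n Nn; rewrite hN // ler_wpM2r ?invr_ge0 // ltW.
have omP n : omega n.+1 = P n.+1 / n.+1%:R.
  by rewrite omE // /P -[in RHS]mulr_powRB1 // mulrAC mulfV ?mul1r ?pnatr_eq0.
have P0 n : 0 < P n.+1 by apply: powR_gt0; rewrite ltr0n.
have S0 n : 0 < \sum_(0 <= i < n.+1) omega i.
  by rewrite big_nat_recr //= ltr_wpDl // sumr_ge0 // => i _; exact: ltW.
split.
  exists (2 * A + 1) => n n0.
  have c0 : 0 < 2 * A + 1 by rewrite addr_gt0 // mulr_gt0.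
  (* In 2 A + 1, the 2 A follows the increments of n^A and the 1 starts the induction. *)
  have lowS k : P k.+1 <= (2 * A + 1) * \sum_(0 <= i < k.+2) omega i.
    elim: k => [|k IH].
      rewrite big_nat_recr //= big_nat1 omP divr1 mulrDr.
      rewrite -[leLHS]add0r lerD ?mulr_ge0 ?(ltW c0) ?(ltW (om0 _)) //.
      by rewrite ler_peMl ?(ltW (P0 _)) // lerDr ltW // mulr_gt0.
    rewrite big_nat_recr //= mulrDr omP.
    have /andP[_ h] := powR_incr (isT : (0 < k.+1)%N).
    have : 0 <= P k.+2 / k.+2%:R by rewrite divr_ge0 // ltW.
    move: h IH; set w := P k.+2 / k.+2%:R; rewrite !mulrDl !mul1r; lra.
  rewrite gE omP ler_pdivrMr // mulrAC.
  apply: le_trans (_ : P n.+1 / n%:R <= _).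
    by rewrite ler_wpM2l ?(ltW (P0 _)) // lef_pV2 ?posrE ?ltr0n // ler_nat.
  by rewrite ler_wpM2r ?invr_ge0.
move=> A' A'A; have [A'0|A'0] := leP A' 0.
  exists 0%N => n _; apply: le_trans (_ : 0 <= _).
    by rewrite mulr_le0_ge0 // invr_ge0.
  by have /andP[/ltW] := g01 n.
(* Three losses: from A to [A2] in the increments of n^A, from [A2] to [A1] for the initial sum [c],
   from [A1] to [A'] for passing from n+1 to n. *)
pose A1 := (2 * A' + A) / 3; pose A2 := (A' + 2 * A) / 3.
have hA1 : A' < A1 by rewrite /A1; lra.
have hA12 : A1 < A2 by rewrite /A1 /A2; lra.
have hA2 : A2 < A by rewrite /A2; lra.
have A10 : 0 < A1 by lra.
have A20 : 0 < A2 by lra.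
pose N1 := (Num.truncn (A * A2 / (A - A2))).+1.
have hN1 n : (N1 <= n)%N -> A2 * (P n.+1 / n.+1%:R) <= P n.+1 - P n.
  move=> Nn; have n0 : (0 < n)%N by apply: leq_trans Nn.
  have /andP[h _] := powR_incr n0; apply: le_trans h.
  apply: ler_wpM2r; first by rewrite divr_ge0 // ltW.
  have n1' : 0 < n.+1%:R :> R by rewrite ltr0n.
  rewrite ler_pdivlMr ?addr_gt0 ?divr_gt0 // mulrDr mulr1 -lerBrDl.
  rewrite mulrA ler_pdivrMr // mulrC -ler_pdivrMl ?subr_gt0 // [leLHS]mulrC.
  by apply: le_trans (ltW (truncnS_gt _)) _; rewrite ler_nat; exact: leqW Nn.
pose c := \sum_(0 <= i < N1.+1) omega i.
have upS k : A2 * \sum_(0 <= i < (N1 + k).+1) omega i <= A2 * c + P (N1 + k)%N.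
  elim: k => [|k IH]; first by rewrite addn0 lerDl powR_ge0.
  rewrite addnS big_nat_recr //= mulrDr omP.
  have := hN1 _ (leq_addr k N1); set w := A2 * (_ / _) => h.
  by apply: le_trans (lerD IH h) _; rewrite addrA [X in X - _]addrAC addrK.
have [|N2 hN2] := @decay_small R A ((A1^-1 - A2^-1) / (c + 1)) A_gt0.
  by rewrite divr_gt0 ?subr_gt0 ?ltf_pV2 ?posrE // addr_gt0 // S0.
pose N3 := (Num.truncn (A' / (A1 - A'))).+1.
exists (N1 + (N2 + N3))%N => n Nn.
have n1 : (N1 <= n)%N by apply: leq_trans Nn; rewrite leq_addr.
have n2 : (N2 <= n.+1)%N.
  by apply: leqW; apply: leq_trans Nn; rewrite addnCA leq_addr.
have n3 : A' / (A1 - A') <= n%:R.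
  apply: le_trans (ltW (truncnS_gt _)) _; rewrite ler_nat.
  by apply: leq_trans Nn; rewrite addnA leq_addl.
have n0' : 0 < n%:R :> R by rewrite ltr0n; apply: leq_trans n1.
have n1' : 0 < n.+1%:R :> R by rewrite ltr0n.
have hS := upS (n.+1 - N1)%N; rewrite subnKC ?(leqW n1) // in hS.
apply: le_trans (_ : A1 / n.+1%:R <= _).
  rewrite ler_pdivrMr // mulrAC ler_pdivlMr // -natr1.
  rewrite ler_pdivrMr ?subr_gt0 // in n3; lra.
have {}hN2 := hN2 _ n2; rewrite ler_pdivlMr in hN2; last by rewrite addr_gt0 // S0.
have PV : decay A n.+1 = (P n.+1)^-1 by rewrite /decay powRN.
rewrite PV in hN2.
have hc : c <= (A1^-1 - A2^-1) * P n.+1.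
  rewrite -ler_pdivrMr // mulrC; apply: le_trans hN2.
  by rewrite ler_wpM2l ?invr_ge0 ?(ltW (P0 _)) // lerDl.
rewrite gE omP ler_pdivlMr // mulrAC ler_wpM2r ?invr_ge0 //.
have hS' : \sum_(0 <= i < n.+2) omega i <= c + P n.+1 / A2.
  by rewrite -(ler_pM2l A20) mulrDr [A2 * (_ / _)]mulrCA mulfV ?gt_eqF // mulr1.
apply: le_trans (_ : A1 * (P n.+1 / A1) <= _); last by rewrite mulrCA mulfV ?gt_eqF // mulr1.
rewrite ler_pM2l //; apply: le_trans hS' _; lra.
Qed.

End StepSizes.

(** * Finite-horizon expectations and the maximal inequality *)

Section History.
Context {R : realType} {T : finType} {disp : measure_display}
  {Omega : measurableType disp}.
Implicit Types (X : nat -> Omega -> T) (n : nat) (s : seq T).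

(** Latest state first: the head is the current state, and a list of size n+1 encodes time n. *)
Fixpoint hist X n (w : Omega) : seq T :=
  if n is n'.+1 then X n w :: hist X n' w else [:: X 0%N w].

Lemma size_hist X n w : size (hist X n w) = n.+1.
Proof. by elim: n => //= n ->. Qed.

Lemma history_sub X m n : (m <= n)%N -> history X m `<=` history X n.
Proof.
move=> mn; apply: sub_sigma_algebra2 => _ [k [j [km ->]]].
by exists k, j; rewrite (leq_trans km mn).
Qed.

Lemma history_state X n j : history X n (X n @^-1` [set j]).
Proof. by apply: sub_sigma_algebra; exists n, j. Qed.

Lemma history_hist X n s : history X n [set w | hist X n w = s].
Proof.
have mI m A B : history X m A -> history X m B -> history X m (A `&` B).
  exact: (@measurableI _ (g_sigma_algebraType _)).
have m0 m : history X m set0 by exact: (@measurable0 _ (g_sigma_algebraType _)).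
elim: n s => [|n IH] [|j s].
- have -> : [set w | hist X 0 w = [::]] = set0 by rewrite -subset0 => w /=.
  exact: m0.
- case: s => [|j' s].
    have -> : [set w | hist X 0 w = [:: j]] = X 0%N @^-1` [set j]; last exact: history_state.
    by apply/seteqP; split => w /= [->].
  have -> : [set w | hist X 0 w = [:: j, j' & s]] = set0 by rewrite -subset0 => w /=.
  exact: m0.
- have -> : [set w | hist X n.+1 w = [::]] = set0 by rewrite -subset0 => w /=.
  exact: m0.
have -> : [set w | hist X n.+1 w = j :: s] = X n.+1 @^-1` [set j] `&` [set w | hist X n w = s].
  by apply/seteqP; split => w /= [-> ->].
by apply: mI; [exact: history_state | apply: (history_sub (leqnSn n)) (IH s)].
Qed.

(** The sets that do not separate w from w' form a sigma-algebra containing the generators. *)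
Lemma history_separation X n (A : set Omega) w w' :
  history X n A -> (forall k, (k <= n)%N -> X k w = X k w') -> A w -> A w'.
Proof.
move=> hA e; suff : A w <-> A w' by case.
move: A hA; apply: smallest_sub; last first.
  by move=> _ [k [j [kn ->]]]; rewrite /preimage /= e.
split.
- by [].
- by move=> A [h1 h2]; split=> -[_ nA]; split=> // ?; apply: nA; [exact: h2|exact: h1].
by move=> F hF; split=> -[i _ Fi]; exists i => //; apply/hF.
Qed.

End History.

Section FiniteHorizon.
Context {R : realType} {T : finType} {disp : measure_display}
  {Omega : measurableType disp} (Pr : probability Omega R)
  (X : nat -> Omega -> T) (K : seq T -> T -> R).
Hypothesis mX : forall n j, measurable (X n @^-1` [set j]).
Hypothesis K_ge0 : forall s j, 0 <= K s j.
Hypothesis K_sum1 : forall s, \sum_j K s j = 1.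
Hypothesis XK : forall n j, is_cond_prob Pr (history X n) (X n.+1 @^-1` [set j])
  (fun w => K (hist X n w) j).
Implicit Types (n : nat) (s : seq T) (f g : seq T -> R).

Lemma measurable_hist n s : measurable [set w | hist X n w = s].
Proof.
have := @history_hist _ _ _ X n s; move: [set w | _]; apply: smallest_sub.
  split; [exact: measurable0|by move=> A mA; exact: measurableD|].
  by move=> F mF; apply: bigcup_measurable => k _; exact: mF.
by move=> _ [k [j [_ ->]]].
Qed.

(* The expectation of f (hist X n). *)
Fixpoint mean n f : R :=
  if n is n'.+1 then mean n' (fun s => \sum_j K s j * f (j :: s))
  else \sum_j fine (Pr (X 0%N @^-1` [set j])) * f [:: j].

Lemma eq_mean n f g : (forall s, size s = n.+1 -> f s = g s) -> mean n f = mean n g.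
Proof.
elim: n f g => [|n IH] f g fg /=; first by apply: eq_bigr => j _; rewrite fg.
by apply: IH => s ss; apply: eq_bigr => j _; rewrite fg //= ss.
Qed.

Lemma ler_mean n f g : (forall s, size s = n.+1 -> f s <= g s) -> mean n f <= mean n g.
Proof.
elim: n f g => [|n IH] f g fg /=.
  by apply: ler_sum => j _; rewrite ler_wpM2l ?fine_ge0 // fg.
by apply: IH => s ss; apply: ler_sum => j _; rewrite ler_wpM2l // fg //= ss.
Qed.

Lemma meanD n f g : mean n (fun s => f s + g s) = mean n f + mean n g.
Proof.
elim: n f g => [|n IH] f g /=.
  by rewrite -big_split; apply: eq_bigr => j _; rewrite mulrDr.
rewrite -IH; apply: eq_mean => s _.
by rewrite -big_split; apply: eq_bigr => j _; rewrite mulrDr.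
Qed.

Lemma meanZ n c f : mean n (fun s => c * f s) = c * mean n f.
Proof.
elim: n f => [|n IH] f /=.
  by rewrite mulr_sumr; apply: eq_bigr => j _; rewrite mulrCA.
rewrite -IH; apply: eq_mean => s _.
by rewrite mulr_sumr; apply: eq_bigr => j _; rewrite mulrCA.
Qed.

(** The transition probability is constant on the event that the history equals [s], so integrating
    it there multiplies the probability by K s j. *)
Lemma mean_atom n s : size s = n.+1 ->
  (mean n (fun u => (u == s)%:R))%:E = Pr [set w | hist X n w = s].
Proof.
elim: n s => [|n IH] [|j s] //= [ss].
  rewrite (bigD1 j) //= big1 => [|i ij]; last first.
    by rewrite (_ : _ == _ = false) ?mulr0 // eqseq_cons (negbTE ij).
  move/size0nil: ss => ->; rewrite eqxx mulr1 addr0 fineK ?fin_num_measure //.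
  by congr (Pr _); apply/seteqP; split => w /= [->].
transitivity (mean n (fun u => K s j * (u == s)%:R))%:E.
  congr EFin; apply: eq_mean => u _.
  rewrite (bigD1 j) //= big1 => [|i ij]; last first.
    by rewrite eqseq_cons (negbTE ij) mulr0.
  rewrite addr0 eqseq_cons eqxx /=.
  by have [->//|_] := eqVneq u s; rewrite !mulr0.
rewrite meanZ EFinM IH // -integral_cst; last exact: measurable_hist.
rewrite (eq_integral (fun w => (K (hist X n w) j)%:E)); last first.
  by move=> w /set_mem /= ->.
rewrite ((XK n j).2 _ (@history_hist _ _ _ X n s)).
by congr (Pr _); apply/seteqP; split => w /= [-> ->].
Qed.

Lemma mean_prob n (b : pred (seq T)) :
  measurable [set w | b (hist X n w)] /\
  Pr [set w | b (hist X n w)] = (mean n (fun s => (b s)%:R))%:E.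
Proof.
(* There are finitely many histories of length n+1; listing those that satisfy [b] permits an
   induction that adds one atom at a time. *)
pose l := [seq s <- [seq val t | t <- enum {: n.+1.-tuple T}] | b s].
have lb s : size s = n.+1 -> (s \in l) = b s.
  move=> ss; rewrite mem_filter andb_idr // => _.
  by apply/mapP; exists (Tuple (introT eqP ss)); rewrite ?mem_enum.
suff H : measurable [set w | hist X n w \in l] /\
    Pr [set w | hist X n w \in l] = (mean n (fun s => (s \in l)%:R))%:E.
  have e : [set w | b (hist X n w)] = [set w | hist X n w \in l].
    by apply/seteqP; split => w /=; rewrite lb ?size_hist.
  rewrite e; case: H => ? ->; split => //; congr EFin.
  by apply: eq_mean => s ss; rewrite lb.
have ul : uniq l by rewrite filter_uniq // map_inj_uniq ?enum_uniq //; exact: val_inj.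
have sl s : s \in l -> size s = n.+1.
  by rewrite mem_filter => /andP[_ /mapP[t _ ->]]; rewrite size_tuple.
elim: l ul sl {lb} => [|s l IH] /=.
  move=> _ _; rewrite (_ : [set _ | _] = set0); last by apply/seteqP; split.
  split => //; rewrite measure0 (_ : mean n _ = 0) //.
  by rewrite -[RHS](mul0r (mean n (fun=> 0))) -meanZ; apply: eq_mean => s _; rewrite mul0r.
move=> /andP[sl ul] hl.
have [m1 e1] := IH ul (fun u ul' => hl u (mem_behead (s := s :: l) ul')).
rewrite (_ : [set _ | _] = [set w | hist X n w = s] `|` [set w | hist X n w \in l]).
  split; first by apply: measurableU => //; exact: measurable_hist.
  rewrite measureU //.
  - transitivity ((mean n (fun u => (u == s)%:R))%:E + (mean n (fun u => (u \in l)%:R))%:E)%E.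
      by rewrite mean_atom ?hl ?mem_head // -e1.
    rewrite -EFinD -meanD; congr EFin.
    apply: eq_mean => u _; rewrite in_cons; case: eqVneq => [->|_] /=.
      by rewrite (negbTE sl) addr0.
    by rewrite add0r.
  - exact: measurable_hist.
  by rewrite -subset0 => w /= [e]; rewrite e (negbTE sl).
apply/seteqP; split => w /=; rewrite in_cons.
  by move=> /orP[/eqP|]; [left|right].
by case=> ->; rewrite ?eqxx ?orbT.
Qed.

Lemma mean1 n : mean n (fun _ => 1) = 1.
Proof.
have [_ /esym] := mean_prob n xpredT.
by rewrite (_ : [set _ | _] = setT) ?probability_setT; [case | apply/seteqP; split].
Qed.

(** * Almost sure boundedness of martingales with square-summable increments *)

Section Maximal.
Variables (phi : nat -> seq T -> T -> R) (beta : nat -> R) (S : R).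
Hypothesis phi_bound : forall n s j, `|phi n s j| <= beta n.
Hypothesis phi_mean0 : forall n s, size s = n.+1 -> \sum_j K s j * phi n s j = 0.
Hypothesis beta_sum : forall n, \sum_(0 <= k < n) beta k ^+ 2 <= S.

Definition mart n w : R := \sum_(0 <= k < n) phi k (hist X k w) (X k.+1 w).

(* The martingale stopped when it first reaches the level a in absolute value. *)
Fixpoint stopped (a : R) s : R :=
  if s is j :: s' then
    if s' is _ :: s'' then
      if a <= `|stopped a s'| then stopped a s'
      else stopped a s' + phi (size s'') s' j
    else 0
  else 0.

Lemma stoppedS a j s n : size s = n.+1 -> stopped a (j :: s) =
  if a <= `|stopped a s| then stopped a s else stopped a s + phi n s j.
Proof. by case: s => // i s /= [->]. Qed.
Arguments stopped : simpl never.

(** Increments are orthogonal: the cross term vanishes by [phi_mean0], and a stopped path adds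
    nothing. *)
Lemma mean_stopped_sqr a n : mean n (fun s => stopped a s ^+ 2) <= S.
Proof.
apply: le_trans (beta_sum n).
elim: n => [|n IH].
  by rewrite big_geq //= big1 // => j _; rewrite expr0n mulr0.
rewrite big_nat_recr //=.
apply: le_trans (_ : mean n (fun s => stopped a s ^+ 2 + beta n ^+ 2 * 1) <= _).
  apply: ler_mean => s ss.
  under eq_bigr do rewrite (stoppedS _ _ ss).
  have [_|_] := boolP (a <= `|stopped a s|).
    by rewrite -mulr_suml K_sum1 mul1r lerDl mulr1 sqr_ge0.
  rewrite (eq_bigr (fun j => stopped a s ^+ 2 * K s j +
      (2 * stopped a s) * (K s j * phi n s j) + K s j * phi n s j ^+ 2)); last first.
    by move=> j _; ring.
  rewrite !big_split /= -!mulr_sumr K_sum1 phi_mean0 // mulr0 addr0 mulr1 lerD2l.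
  apply: le_trans (_ : \sum_j K s j * beta n ^+ 2 <= _).
    apply: ler_sum => j _; rewrite ler_wpM2l // -real_normK ?num_real //.
    have := phi_bound n s j => h; rewrite ler_pXn2r // nnegrE //.
    exact: le_trans h.
  by rewrite -mulr_suml K_sum1 mul1r mulr1.
by rewrite meanD meanZ mean1 mulr1 lerD2r.
Qed.

Let hit a n := [set w | a <= `|stopped a (hist X n w)|].

Lemma measurable_hit a n : measurable (hit a n).
Proof. exact: (mean_prob n (fun s => a <= `|stopped a s|)).1. Qed.

(** Chebyshev at the final time controls the whole path, because the stopped process never leaves
    the level once reached. *)
Lemma prob_hit a n : 0 < a -> (Pr (hit a n) <= (S / a ^+ 2)%:E)%E.
Proof.
move=> a0; rewrite /hit (mean_prob n (fun s => a <= `|stopped a s|)).2 lee_fin.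
apply: le_trans (_ : mean n (fun s => a ^- 2 * stopped a s ^+ 2) <= _).
  apply: ler_mean => s _; rewrite mulrC ler_pdivlMr ?exprn_gt0 //.
  case: (leP a _) => /= [h|_]; last by rewrite mul0r sqr_ge0.
  rewrite mul1r -[leRHS]real_normK ?num_real // ler_pXn2r // nnegrE //.
  exact: ltW.
by rewrite meanZ [leRHS]mulrC ler_wpM2l ?invr_ge0 ?sqr_ge0 // mean_stopped_sqr.
Qed.

Lemma hit_incr a n : hit a n `<=` hit a n.+1.
Proof. by move=> w h; rewrite /hit /= (@stoppedS _ _ _ n) ?size_hist // h. Qed.

Lemma hit_sub a m n : (m <= n)%N -> hit a m `<=` hit a n.
Proof.
move=> /subnKC <-; elim: (n - m)%N => [|k IH]; first by rewrite addn0.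
by rewrite addnS => w /IH; exact: hit_incr.
Qed.

Lemma stopped_mart a n w : 0 < a -> ~ hit a n w -> stopped a (hist X n w) = mart n w.
Proof.
move=> a0; elim: n => [|n IH] h; first by rewrite /mart big_geq.
have h' : ~ hit a n w by move=> /hit_incr.
rewrite /= (@stoppedS _ _ _ n) ?size_hist // IH // /mart big_nat_recr //= ifF //.
by apply/negbTE/negP; rewrite -/(mart n w) -IH.
Qed.

Lemma bounded_martingale : {ae Pr, forall w, exists L, forall n, `|mart n w| <= L}.
Proof.
pose bad := \bigcap_(a : nat) \bigcup_n hit a.+1%:R n.
have mU a : measurable (\bigcup_n hit a n).
  by apply: bigcup_measurable => n _; exact: measurable_hit.
have mbad : measurable bad by apply: bigcap_measurable => // a _; exact: mU.
have S0 : 0 <= S by apply: le_trans (beta_sum 0); rewrite big_geq.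
have PU a : 0 < a -> (Pr (\bigcup_n hit a n) <= (S / a ^+ 2)%:E)%E.
  move=> a0; have cv := @nondecreasing_cvg_mu _ _ _ Pr (hit a)
    (measurable_hit a) (mU a) _.
  rewrite -(cvg_lim _ (cv _)) //; last by move=> m n mn; apply/subsetPset/hit_sub.
  apply: lime_le; last by apply: nearW => n; exact: prob_hit.
  by apply/cvg_ex; eexists; apply: cv => m n mn; apply/subsetPset/hit_sub.
exists bad; split => //.
  apply/eqP; rewrite eq_le measure_ge0 andbT.
  apply/lee_addgt0Pr => e e0; rewrite add0e.
  (* Then S/(a+1)^2 <= S/(a+1) <= e. *)
  pose a := Num.truncn (S / e).
  have aS : S / e <= a.+1%:R by apply/ltW/truncnS_gt.
  apply: le_trans (_ : (Pr (\bigcup_n hit a.+1%:R n) <= _)%E).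
    by apply: le_measure; rewrite ?inE // => w; apply.
  apply: le_trans (PU _ _) _; rewrite ?ltr0n // lee_fin ler_pdivrMr ?exprn_gt0 //.
  rewrite mulrC -ler_pdivrMr //; apply: le_trans aS _.
  by rewrite expr2 ler_peMl // ler1n.
move=> w /= nb a _; apply: contrapT => h; apply: nb; exists a.+1%:R => n.
have hn : ~ hit a.+1%:R n w by move=> hn; apply: h; exists n.
rewrite -(@stopped_mart a.+1%:R n w) // ?ltr0n //.
by apply/ltW; rewrite ltNge; apply/negP.
Qed.

End Maximal.
End FiniteHorizon.

(** * The resampling process *)

(** The pointwise constants need not be measurable, so they are replaced by one plus the supremum of
    n^theta g_n over n >= 1. Where that is infinite, [fine] returns 0 and the constant is 1. *)
Lemma random_bound (R : realType) (disp : measure_display) (Omega : measurableType disp)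
    (Pr : probability Omega R) (g : nat -> Omega -> R) (theta : R) :
  (forall n, measurable_fun setT (g n)) -> (forall n w, 0 <= g n w) ->
  {ae Pr, forall w, exists L, forall n, (0 < n)%N -> g n w <= L * decay theta n} ->
  exists C : {RV Pr >-> R}, (forall w, 0 < C w) /\
    {ae Pr, forall w, forall n, (1 <= n)%N -> g n w <= C w * n%:R `^ (- theta)}.
Proof.
move=> mg g0 gL.
pose f n w : \bar R := ((decay theta n.+1)^-1 * g n.+1 w)%:E.
pose C w : R := 1 + fine (esups (f ^~ w) 0%N).
have f0 n w : (0 <= f n w)%E by rewrite lee_fin mulr_ge0 ?invr_ge0 ?decay_ge0.
have fsup n w : (f n w <= esups (f ^~ w) 0%N)%E.
  by apply: ereal_sup_ubound; exists n.
have mC : measurable_fun setT C.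
  apply: measurable_funD; first exact: measurable_cst.
  apply: (measurableT_comp (fine_measurable measurableT)).
  apply: measurable_fun_esups => n; apply/measurable_EFinP.
  by apply: measurable_funM; [exact: measurable_cst|exact: mg].
pose CR : {mfun Omega >-> R} := HB.pack C (isMeasurableFun.Build _ _ _ _ C mC).
exists CR; split=> [w|].
  rewrite /= /C ltr_pwDl // fine_ge0 //; exact: le_trans (f0 0%N w) (fsup 0%N w).
apply: filterS gL => w [L hL] [//|n] _; rewrite -/(decay theta n.+1) /= /C.
rewrite mulrC -ler_pdivrMl ?decay_gt0 //.
have sup_le : (esups (f ^~ w) 0%N <= L%:E)%E.
  apply: ge_ereal_sup => _ [k _ <-]; rewrite lee_fin mulrC ler_pdivrMr ?decay_gt0 //.
  exact: hL.
have sup_fin : esups (f ^~ w) 0%N \is a fin_num.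
  rewrite ge0_fin_numE; first by apply: le_lt_trans sup_le _; rewrite ltry.
  exact: le_trans (f0 0%N w) (fsup 0%N w).
have := fsup n w; rewrite -{1}(fineK sup_fin) lee_fin => h.
by apply: le_trans h _; rewrite lerDr.
Qed.

Section StateSpace.
Context {R : realType} {F : finType} (o : F) (P : F -> F -> R).
Hypothesis hP : stochastic P.
Hypothesis habs : forall i, i != o -> P o i = 0.

Lemma sum_star (f : F -> R) : \sum_i f i = f o + \sum_(i : star o) f (val i).
Proof.
rewrite (bigD1 o) //=; congr (_ + _).
exact: (big_sub (fun i => i != o) f).
Qed.

Lemma sum_enum_val (T : finType) (f : T -> R) : \sum_(i < #|T|) f (enum_val i) = \sum_t f t.
Proof. by rewrite -big_enum_val. Qed.

(** A path from S to another state of F^* would have to leave S directly or through [o], which is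
    absorbing. *)
Lemma kernel_iter_closed (S : pred (star o)) k (i j : star o) :
  (forall i j : star o, S i -> 0 < P (val i) (val j) -> S j) ->
  S i -> ~~ S j -> kernel_iter P k (val i) (val j) = 0.
Proof.
have [P0 _] := hP; move=> hS Si; rewrite /kernel_iter; elim: k j => [|k IH] j Sj.
  rewrite expr0 mxE; case: eqP => // /enum_rank_inj/val_inj e.
  by move: Sj; rewrite -e Si.
rewrite exprSr -[_ * _]/(_ *m _) mxE big1 // => l _.
have -> : mx_of_kernel P l (enum_rank (val j)) = P (enum_val l) (val j).
  by rewrite mxE enum_rankK.
have [lo|lo] := eqVneq (enum_val l) o; first by rewrite lo habs ?mulr0 //; exact: valP j.
have [Sl|Sl] := boolP (S (exist _ (enum_val l) lo)).
  suff -> : P (enum_val l) (val j) = 0 by rewrite mulr0.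
  apply/eqP; rewrite eq_le P0 andbT leNgt; apply/negP => Plj.
  by move: Sj; rewrite (hS _ _ Sl Plj).
by have := IH _ Sl; rewrite /= enum_valK => ->; rewrite mul0r.
Qed.

Lemma irreducible_closed (S : pred (star o)) : irreducible_class P o ->
  (exists i, S i) -> (forall i j : star o, S i -> 0 < P (val i) (val j) -> S j) ->
  forall j, S j.
Proof.
move=> hirr [i Si] hS j; apply: contraT => Sj.
have := hirr i j; rewrite eseries0 ?ltxx // => k _ _.
by rewrite (kernel_iter_closed _ hS Si Sj).
Qed.

End StateSpace.

Section RateGap.
Context {R : realType} (d : nat) (lambda : R) (lam : nat -> R[i]).

Lemma rate_drift_eigenvalue (i : nat) : lambda < 1 -> (2 <= i < d.+1)%N ->
  rate d lambda lam / (1 - lambda) <= - complex.Re (drift_eigenvalue lambda lam i).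
Proof.
move=> l1 id; have l0 : 0 < 1 - lambda by rewrite subr_gt0.
rewrite /drift_eigenvalue /rate; set m := \big[_/_]_(_ <- _ | _) _.
have le_m : complex.Re (1 / (1 - lam i)) <= m.
  by apply: (bigmax_sup_seq _ i); rewrite ?mem_index_iota.
have -> : complex.Re (1 / (1 - lam i) - real_complex R (1 - lambda)^-1) =
    complex.Re (1 / (1 - lam i)) - (1 - lambda)^-1.
  by case: (1 / (1 - lam i)).
have -> : (1 - (1 - lambda) * m) / (1 - lambda) = (1 - lambda)^-1 - m.
  by field; rewrite gt_eqF.
lra.
Qed.

End RateGap.

Section Rows.
Context {R : realType} {T : finType}.
Implicit Types f g : T -> R.

Definition row_of f : 'rV[R]_#|T| := \row_i f (enum_val i).

Lemma row_simplex_of f : simplex f -> row_simplex (row_of f).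
Proof.
move=> [f0 f1]; split=> [i|]; first by rewrite mxE.
by under eq_bigr do rewrite mxE; rewrite sum_enum_val.
Qed.

Lemma dist1_row_of f g : dist1 (row_of f) (row_of g) = norm1 (fun i => f i - g i).
Proof.
by rewrite /norm1 -[RHS]sum_enum_val; apply: eq_bigr => i _; rewrite !mxE.
Qed.

Lemma row_of_lincomb a b f g :
  row_of (fun i => a * f i + b * g i) = a *: row_of f + b *: row_of g.
Proof. by apply/rowP => i; rewrite !mxE. Qed.

Lemma row_of_dirac (t : T) : row_of (dirac_mass t) = unit_row (enum_rank t).
Proof.
apply/rowP => i; rewrite !mxE eqxx /dirac_mass /=.
by rewrite -(inj_eq enum_val_inj) enum_rankK.
Qed.

Lemma norm1_simplex f g : simplex f -> simplex g -> norm1 (fun i => f i - g i) <= 2.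
Proof.
move=> [f0 f1] [g0 g1]; apply: le_trans (_ : \sum_i (f i + g i) <= _).
  by apply: ler_sum => i _; apply: le_trans (ler_normB _ _) _; rewrite !ger0_norm.
by rewrite big_split /= f1 g1.
Qed.

End Rows.

Section Killed.
Context {R : realType} {F : finType} (o : F) (P : F -> F -> R).
Hypothesis hP : stochastic P.
Hypothesis habs : forall i, i != o -> P o i = 0.
Hypothesis hirr : irreducible_class P o.

Let M : 'M[R]_#|{: star o}| := mx_of_kernel (@hat R F P o).

Lemma killed_mx_ge0 i j : 0 <= M i j.
Proof. by rewrite mxE; apply: hP.1. Qed.

Lemma killed_mx_irreducible (S : pred 'I_#|{: star o}|) : (exists i, S i) ->
  (forall i j, S i -> 0 < M i j -> S j) -> forall j, S j.
Proof.
move=> [i Si] hS j; rewrite -(enum_valK j).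
apply: (@irreducible_closed _ _ _ _ hP habs (fun t => S (enum_rank t)) hirr) => [|a b Sa Pab].
  by exists (enum_val i); rewrite enum_valK.
by apply: hS Sa _; rewrite mxE !enum_rankK.
Qed.

Lemma resampling_ge0 (x : star o -> R) i j : simplex x -> 0 <= resampling_kernel P x i j.
Proof. by move=> [x0 _]; rewrite addr_ge0 ?mulr_ge0 ?hP.1. Qed.

Lemma resampling_sum1 (x : star o -> R) i : simplex x -> \sum_j resampling_kernel P x i j = 1.
Proof.
move=> [_ x1]; rewrite big_split /= -mulr_sumr x1 mulr1 -(hP.2 (val i)).
by rewrite (sum_star o) addrC.
Qed.

Lemma next_law_resampling (x : star o -> R) i :
  next_law M (row_of x) (enum_rank i) = row_of (resampling_kernel P x i).
Proof.
have MiE l : (unit_row (enum_rank i) *m M) 0 l = P (val i) (val (enum_val l)).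
  by rewrite -rowE !mxE enum_rankK.
have pE : exit_prob M (enum_rank i) = P (val i) o.
  rewrite /exit_prob mxE; under eq_bigr do rewrite MiE mxE mulr1.
  rewrite (sum_enum_val (fun t : star o => P (val i) (val t))).
  by rewrite -(hP.2 (val i)) (sum_star o) addrK.
by apply/rowP => l; rewrite /next_law pE mxE MiE !mxE.
Qed.

End Killed.

Section Process.
Context {R : realType} {F : finType} (o : F) (P : F -> F -> R).
Hypothesis hP : stochastic P.
Context {disp : measure_display} {Omega : measurableType disp}
  (Pr : probability Omega R) (X : nat -> Omega -> star o)
  (x : nat -> Omega -> (star o -> R)) (gamma : nat -> R) (nu : star o -> R).
Hypothesis hX : forall n j, measurable (X n @^-1` [set j]).
Hypothesis nu_simplex : simplex nu.
Hypothesis x_simplex : forall n w, simplex (x n w).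
Hypothesis hx0 : forall j, measurable_wrt (history X 0) (fun w => x 0%N w j).
Hypothesis hX_cond : forall n j,
  is_cond_prob Pr (history X n) (X n.+1 @^-1` [set j])
    (fun w => resampling_kernel P (x n w) (X n w) j).
Hypothesis hx_rec : forall n w j,
  x n.+1 w j = (1 - gamma n) * x n w j + gamma n * dirac_mass (X n.+1 w) j.
Hypothesis gamma01 : forall n, 0 < gamma n < 1.

(** The event x_0(i) = c belongs to the sigma-algebra of X_0, so it contains all outcomes with the
    same X_0 as one of its points. States never taken by X_0 receive nu. *)
Lemma initial_measure : exists x0 : star o -> star o -> R,
  (forall j, simplex (x0 j)) /\ forall w, x 0%N w = x0 (X 0%N w).
Proof.
suff /choice[x0 hx] : forall j : star o, exists y : star o -> R,
    simplex y /\ forall w, X 0%N w = j -> x 0%N w = y.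
  by exists x0; split=> [j|w]; [exact: (hx j).1 | exact: (hx (X 0%N w)).2].
move=> j; have [[w0 e0]|nw] := pselect (exists w, X 0%N w = j); last first.
  by exists nu; split => // w e; case: nw; exists w.
exists (x 0%N w0); split => // w e; apply/funext => i.
have := hx0 i (measurable_set1 (x 0%N w0 i)) => h.
apply: (history_separation (w := w0) (w' := w) h) => // k; rewrite leqn0 => /eqP ->.
by rewrite e e0.
Qed.

(* Off the actual trajectories xs still takes values in the simplex, so that the
   transition probabilities built from it are stochastic everywhere. *)
Lemma measure_of_trajectory : exists xs : seq (star o) -> star o -> R,
  (forall s, simplex (xs s)) /\ forall n w, x n w = xs (hist X n w).
Proof.
have [x0 [x0s x0E]] := initial_measure.
pose fix xs (s : seq (star o)) : star o -> R :=
  match s with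
  | [::] => nu
  | j :: s' => if s' is _ :: s'' then
      (fun i => (1 - gamma (size s'')) * xs s' i + gamma (size s'') * dirac_mass j i)
      else x0 j
  end.
exists xs; split=> [s|n w].
  elim: s => [|j [|i s] IH]; [exact: nu_simplex|exact: x0s|have [y0 y1] := IH].
  have /andP[/ltW g0 /ltW g1] := gamma01 (size s).
  split=> [k|]; last first.
    rewrite big_split /= -!mulr_sumr y1 (bigD1 j) //= big1 => [|k kj].
      by rewrite /dirac_mass eqxx addr0 !mulr1 subrK.
    by rewrite /dirac_mass (negbTE kj).
  by rewrite /= addr_ge0 ?mulr_ge0 ?subr_ge0 //; rewrite /dirac_mass ler0n.
elim: n => [|n IH]; first by rewrite x0E.
have szh := size_hist X n w; rewrite [hist _ _ _]/=.
move: IH szh; case: (hist X n w) => // i s IH [sz].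
by apply/funext => j; rewrite hx_rec IH /= sz.
Qed.

Variables (G : 'M[R]_#|{: star o}|) (lambda : R) (h : 'cV[R]_#|{: star o}|).
Let M : 'M[R]_#|{: star o}| := mx_of_kernel (@hat R F P o).
Hypothesis corrector_lipb : forall i l, lipschitz_bounded (fun y => corrector G lambda h y i l).

Lemma process_measurable (f : (star o -> R) -> R) n : measurable_fun setT (fun w => f (x n w)).
Proof.
have [xs [xss xE]] := measure_of_trajectory.
(* On the empty list, which is never a history, nu keeps [K] stochastic. *)
pose K (s : seq (star o)) j : R :=
  if s is i :: _ then resampling_kernel P (xs s) i j else nu j.
move=> _ B mB; rewrite setTI.
have -> : (fun w => f (x n w)) @^-1` B = [set w | `[< B (f (xs (hist X n w))) >]].
  by apply/seteqP; split => w /=; rewrite xE => /asboolP.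
apply: (@mean_prob _ _ _ _ Pr X K _ _ n (fun s => `[< B (f (xs s)) >])).1 => //.
move=> m j; have := hX_cond m j; congr is_cond_prob; apply/funext => w.
by rewrite xE /K; case: m => [|m].
Qed.

Lemma noise_small_tails theta Gamma (l : 'I_#|{: star o}|) : 0 < theta < 1 / 2 ->
  (forall n, (0 < n)%N -> gamma n <= Gamma / n%:R) ->
  {ae Pr, forall w, small_tails theta (fun n =>
     gamma n * noise M G lambda h (fun n => row_of (x n w)) (fun n => enum_rank (X n w)) n 0 l)}.
Proof.
move=> /andP[t0 t12] gG.
have [xs [xss xE]] := measure_of_trajectory.
pose K (s : seq (star o)) j : R :=
  if s is i :: _ then resampling_kernel P (xs s) i j else nu j.
have K0 s j : 0 <= K s j.
  by case: s => [|i s] /=; [exact: nu_simplex.1 | exact: resampling_ge0].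
have K1 s : \sum_j K s j = 1.
  by case: s => [|i s] /=; [exact: nu_simplex.2 | exact: resampling_sum1].
have XK n j : is_cond_prob Pr (history X n) (X n.+1 @^-1` [set j])
    (fun w => K (hist X n w) j).
  have := hX_cond n j; congr is_cond_prob; apply/funext => w.
  by rewrite xE /K; case: n => [|n].
pose c s i := corrector G lambda h (row_of (xs s)) i l.
pose m s := \sum_j K s j * c s (enum_rank j).
(* Shifted by one: [noise] at k is the increment from time k+1 to k+2, here weighted by k^theta. *)
pose phi n s j : R := if n is k.+1 then
  (decay theta k)^-1 * (gamma k * (c s (enum_rank j) - m s)) else 0.
have [C cC] : exists C, forall s i, `|c s i| <= C.
  have /choice[D hD] : forall i, exists D, forall s, `|c s i| <= D.
    move=> i; have [D _ hD] := corrector_lipb i l; exists D => s.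
    by have [] := hD _ _ (row_simplex_of (xss s)) (row_simplex_of (xss s)).
  exists (\sum_i `|D i|) => s i; apply: le_trans (hD i s) _.
  by apply: le_trans (ler_norm _) _; rewrite (bigD1 i) //= lerDl sumr_ge0.
have mC s : `|m s| <= C.
  apply: le_trans (ler_norm_sum _ _ _) _; rewrite -[leRHS]mul1r -(K1 s) mulr_suml.
  by apply: ler_sum => j _; rewrite normrM ger0_norm // ler_wpM2l.
pose beta n : R := if n is k.+1 then
  (decay theta k)^-1 * (Gamma / k%:R * (2 * C)) else 0.
have phi_le n s j : `|phi n s j| <= beta n.
  case: n => [|[|k]] /=; first by rewrite normr0.
    (* At k = 0, [decay theta 0] and its inverse are both 0, so the increment and its bound
       vanish. *)
    by rewrite invr0 mulr0 mul0r mulr0 /decay powR0 ?oppr_eq0 ?gt_eqF // invr0 mul0r normr0.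
  have /andP[/ltW g0 _] := gamma01 k.+1.
  rewrite !normrM ger0_norm ?invr_ge0 ?decay_ge0 // ler_wpM2l ?invr_ge0 ?decay_ge0 //.
  rewrite ger0_norm // ler_pM ?gG //.
  by apply: le_trans (ler_normB _ _) _; rewrite mulr2n mulrDl mul1r lerD.
have phi0 n s : size s = n.+1 -> \sum_j K s j * phi n s j = 0.
  move=> _; case: n => [|k] /=; first by rewrite big1 // => j _; rewrite mulr0.
  under eq_bigr do rewrite mulrCA [K _ _ * (_ * _)]mulrCA.
  rewrite -!mulr_sumr; under eq_bigr do rewrite mulrBr.
  by rewrite sumrB -/(m s) -mulr_suml K1 mul1r subrr !mulr0.
(* The squared bounds are of order k^(2 theta - 2) = k^-th / k, summable since th > 0. *)
pose th := 1 - 2 * theta.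
have th0 : 0 < th by rewrite /th; lra.
have betaE k : beta k.+1 ^+ 2 = (Gamma * (2 * C)) ^+ 2 * (decay th k / k%:R).
  case: k => [|k]; first by rewrite /beta invr0 !mulr0 mul0r mulr0 expr0n.
  have k0 : 0 < k.+1%:R :> R by rewrite ltr0n.
  have -> : decay th k.+1 = (decay theta k.+1)^-1 ^+ 2 / k.+1%:R.
    rewrite !decayE // -expRN expr2 -expRD -[X in _ / X]lnK // -expRN -expRD.
    by congr expR; rewrite /th; ring.
  by rewrite /beta; field; rewrite gt_eqF // gt_eqF ?decay_gt0.
have beta_le n : \sum_(0 <= k < n) beta k ^+ 2 <=
    (Gamma * (2 * C)) ^+ 2 * ((2 + th) / th).
  have c0 : 0 <= (2 + th) / th by rewrite divr_ge0 ?(ltW th0) // ltW // addr_gt0.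
  case: n => [|n]; first by rewrite big_geq // mulr_ge0 // sqr_ge0.
  rewrite big_nat_recl // expr0n add0r; under eq_bigr do rewrite betaE.
  rewrite -mulr_sumr ler_wpM2l ?sqr_ge0 //.
  case: n => [|n]; first by rewrite big_geq.
  rewrite big_ltn // invr0 mulr0 add0r.
  by apply: le_trans (decay_sum _ _ _) _; rewrite // /decay powR1 mulr1.
have := bounded_martingale hX K0 K1 XK phi_le phi0 beta_le.
apply: filterS => w [L hL]; apply: (small_tails_weighted t0) => n.
rewrite (_ : \sum_(0 <= k < n) _ = mart X phi n.+1 w); first exact: hL.
rewrite /mart [RHS]big_nat_recl // add0r; apply: eq_bigr => k _.
congr (_ * (_ * _)); rewrite /noise mulmxBl -rowE.
set s := hist X k.+1 w.
have xs1 : x k.+1 w = xs s by rewrite xE.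
rewrite next_law_resampling // xs1 mxE [X in X + _]mxE [X in _ + X]mxE; congr (_ - _).
rewrite mxE /m -[RHS]sum_enum_val; apply: eq_bigr => i _.
by rewrite mxE /c enum_valK.
Qed.

End Process.

Theorem corollary1p3 (R : realType) (F : finType) (o : F) (P : F -> F -> R)
  (hd : (2 <= #|{: star o}|)%N)
  (hP : stochastic P)
  (habs : forall i, i != o -> P o i = 0)
  (hkill : exists i, i != o /\ 0 < P i o)
  (hirr : irreducible_class P o)
  (lambda : R) (nu : star o -> R) (hnu : is_qsd P lambda nu)
  (lam : nat -> R[i]) (hlam : eigenvalue_list P o lambda lam)
  (gamma : nat -> R)
  (hgamma_dec : nonincreasing_seq gamma)
  (hgamma01 : forall n, 0 < gamma n < 1)
  (hgamma_sum : series gamma @ \oo --> +oo)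
  (hgamma_ln : (fun n : nat => gamma n * ln (n%:R : R)) @ \oo --> (0 : R))
  (disp : measure_display) (Omega : measurableType disp)
  (Pr : probability Omega R)
  (X : nat -> Omega -> star o)
  (hX : forall n j, measurable (X n @^-1` [set j]))
  (x : nat -> Omega -> (star o -> R))
  (hx_simplex : forall n w, simplex (x n w))
  (hx0 : forall j, measurable_wrt (history X 0) (fun w => x 0%N w j))
  (hX_cond : forall n j,
     is_cond_prob Pr (history X n) (X n.+1 @^-1` [set j])
       (fun w => resampling_kernel P (x n w) (X n w) j))
  (hx_rec : forall n w j,
     x n.+1 w j = (1 - gamma n) * x n w j + gamma n * dirac_mass (X n.+1 w) j)
  (A : R) (hA : 0 < A)
  (hcase :
     (\forall n \near \oo, gamma n = A / n%:R) \/
     (exists omega : nat -> R,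
        [/\ forall n, 0 < omega n,
            forall n, (1 <= n)%N -> omega n = n%:R `^ (A - 1) &
            forall n, gamma n = omega n.+1 / \sum_(0 <= i < n.+2) omega i])) :
  forall theta : R,
    theta < Num.min (rate #|{: star o}| lambda lam * A) (1 / 2) ->
    exists C : {RV Pr >-> R},
      (forall w, 0 < C w) /\
      {ae Pr, forall w, forall n, (1 <= n)%N ->
         norm1 (fun i => x n w i - nu i) <= C w * n%:R `^ (- theta)}.
Proof.
move=> theta; rewrite lt_min => /andP[thr th2].
have [nus l01 nuP] := hnu; have /andP[l0 l1] := l01.
have [lam_char lam1 _] := hlam.
apply: (@random_bound _ _ _ Pr (fun n w => norm1 (fun i => x n w i - nu i)) theta) => [n|n w|].
- exact: (process_measurable hX nus hx_simplex hx0 hX_cond hx_rec hgamma01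
    (fun y => norm1 (fun i => y i - nu i))).
- exact: sumr_ge0.
(* For theta <= 0 the diameter 2 of the simplex suffices, as n^-theta >= 1. *)
have [t0|t0] := leP theta 0.
  apply: aeW => w; exists 2 => n n0; apply: le_trans (norm1_simplex (hx_simplex n w) nus) _.
  by rewrite ler_peMr // -(decay0 n) ler_decay_exp.
pose M : 'M[R]_#|{: star o}| := mx_of_kernel (@hat R F P o).
have M0 : forall i j, 0 <= M i j by move=> i j; exact: killed_mx_ge0.
have Mirr := killed_mx_irreducible hP habs hirr.
have nur := row_simplex_of nus.
have nuM : row_of nu *m M = lambda *: row_of nu.
  apply/rowP => j; rewrite !mxE -nuP -[RHS]sum_enum_val; apply: eq_bigr => i _.
  by rewrite !mxE.
have [h [h0 Mh nuh]] := right_eigenvector M0 Mirr l01 nur.1 nur.2 nuM.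
pose G := invmx (1%:M - M).
have MG : (1%:M - M) *m G = 1%:M by rewrite mulmxV // (unit_1M M0 l01 h0 Mh).
have G1 := green1_ge1 M0 l01 h0 Mh MG.
have [[Gamma gG] hA'] := stepsize_bounds hA hgamma01 hcase.
have rate0 : 0 < rate #|{: star o}| lambda lam.
  by rewrite -(pmulr_lgt0 _ hA); apply: lt_trans thr.
have noise_ae : {ae Pr, forall w, forall l, small_tails theta (fun n =>
    gamma n * noise M G lambda h (fun n => row_of (x n w))
      (fun n => enum_rank (X n w)) n 0 l)}.
  apply: filter_forall => l.
  apply: (noise_small_tails hP hX nus hx_simplex hx0 hX_cond hx_rec hgamma01
    (lipb_corrector lambda h0 nur G1) l _ gG).
  by rewrite t0.
apply: filterS noise_ae => w hnoise.
have [|||L hL] := @trajectory_decay _ _ M G lambda h (row_of nu) l1 h0 Mh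
  (green_h l01 Mh MG) MG (nu_green l01 nuM MG) nuh nur G1
  (fun n => row_of (x n w)) (fun n => enum_rank (X n w)) gamma Gamma
  (fun n => row_simplex_of (hx_simplex n w)) hgamma01 hgamma_dec gG _ lam
  lam_char lam1 (left_eigenvector_eq0 M0 Mirr l01 h0 Mh)
  theta A (rate #|{: star o}| lambda lam) _ hA rate0 thr hnoise _ hA'.
- move=> n; rewrite -row_of_dirac -row_of_lincomb; congr row_of.
  by apply/funext => j; rewrite hx_rec.
- by rewrite t0; lra.
- by move=> i; exact: rate_drift_eigenvalue.
by exists L => n n0; rewrite -dist1_row_of hL.
Qed.
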